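(* Suppose a tensor $T$ minimal over $X,Y,Z$, together with partitions $X=X_1\cup\dots\cup X_k$, $Y=Y_1\cup\dots\cup Y_k$, $Z=Z_1\cup\dots\cup Z_k$, is a laser-ready tensor partition. Then $\tilde S(T)=\sup_{p\in P^{sym}(L)}p_X$.
   Context: Tensors over a field $\mathbb{F}$; a tensor over finite variable sets $X,Y,Z$ is a trilinear form $\sum\alpha_{xyz}xyz$, minimal if every variable appears in a term with nonzero coefficient. $\langle a,b,c\rangle=\sum_{i\in[a],j\in[b],k\in[c]}x_{ij}y_{jk}z_{ki}$. Degeneration of $T_1$ to $T_2$: substitute each variable of $T_1$ by a linear combination of variables of $T_2$ with coefficients polynomials in a formal variable $\lambda$, so that $T_2$ is the coefficient of some $\lambda^h$ and all lower powers have zero coefficient. Slice rank: $T$ has x-rank 1 if $T=(\sum\alpha_xx)\otimes(\sum\beta_{yz}yz)$; $S_x,S_y,S_z$ are the corresponding minimal numbers of summands; $S(T)=\min\{S_x(T_X)+S_y(T_Y)+S_z(T_Z):T=T_X+T_Y+T_Z\}$; $\tilde S(T)=\limsup_nS(T^{\otimes n})^{1/n}$. Partition notation: $T_{ijk}$ is $T$ with variables outside $X_i,Y_j,Z_k$ set to zero; $L=\{T_{ijk}\ne0\}$; $rot(T)$ is the tensor over $Y,Z,X$ with coefficient of $y_jz_kx_i$ equal to that of $x_iy_jz_k$ in $T$; $T$ is variable-symmetric if $T\simeq rot(T)$ (equal up to renaming). $P^{sym}(L)$ is the set of probability distributions $p$ on $L$ with $p(T_{ijk})=p(T_{jki})$;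 $p(X_i)=\sum_{(j,k):T_{ijk}\in L}p(T_{ijk})$ and $p_X=\prod_{i}(|X_i|/p(X_i))^{p(X_i)}$ (factors with $p(X_i)=0$ equal $1$). Laser-ready tensor partition: (1) for every $(i,j,k)$, either $T_{ijk}=0$ or $T_{ijk}$ has a degeneration to some $\langle a,b,c\rangle$ with $ab=|X_i|$, $bc=|Y_j|$, $ca=|Z_k|$; (2) there is an integer $\ell$ such that $T_{ijk}\ne0$ only if $i+j+k=\ell$; (3) $T$ is variable-symmetric and the partitions are $T$-symmetric, i.e. $|X_i|=|Y_i|=|Z_i|$ for all $i$ and $T_{jki}\simeq rot(T_{ijk})$ for all $i,j,k$. *)

(* Defs.v *)
From HB Require Import structures.
From mathcomp Require Import all_boot all_order all_algebra.
From mathcomp Require Import all_classical all_reals all_analysis.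
Set Implicit Arguments.
Unset Strict Implicit.
Unset Printing Implicit Defensive.
Import Order.TTheory GRing.Theory Num.Theory.
Local Open Scope ring_scope.

(* The value is unspecified when no natural number satisfies [P]. *)
Definition least (P : nat -> Prop) : nat :=
  get (fun n => P n /\ forall m, P m -> (n <= m)%N).

Lemma leastP (P : nat -> Prop) :
  (exists n, P n) -> P (least P) /\ forall m, P m -> (least P <= m)%N.
Proof.
move=> exP; have exb : exists n, `[< P n >].
  by case: exP => n Pn; exists n; apply/asboolP.
rewrite /least; case: xgetP => [n _ //|none].
case: (ex_minnP exb) => n /asboolP Pn minn.
by case: (none n); split=> // m Pm; apply: minn; apply/asboolP.
Qed.

(* [T (x, y, z)] is the coefficient of the monomial xyz. *)
Definition tensor (F : fieldType) (X Y Z : finType) := {ffun X * Y * Z -> F}.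

Section Tensors.
Variable F : fieldType.

Definition minimal (X Y Z : finType) (T : tensor F X Y Z) : Prop :=
  [/\ forall x, exists y z, T (x, y, z) != 0,
      forall y, exists x z, T (x, y, z) != 0
    & forall z, exists x y, T (x, y, z) != 0].

Definition rot_tensor (X Y Z : finType) (T : tensor F X Y Z) : tensor F Y Z X :=
  [ffun v => T (v.2, v.1.1, v.1.2)].

(* T1 and T2 are equal up to renaming of the variables. *)
Definition tensor_eq (X1 Y1 Z1 X2 Y2 Z2 : finType)
    (T1 : tensor F X1 Y1 Z1) (T2 : tensor F X2 Y2 Z2) : Prop :=
  exists (f : X1 -> X2) (g : Y1 -> Y2) (h : Z1 -> Z2),
    [/\ bijective f, bijective g, bijective h
      & forall x y z, T1 (x, y, z) = T2 (f x, g y, h z)].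

Definition variable_symmetric (X Y Z : finType) (T : tensor F X Y Z) : Prop :=
  tensor_eq T (rot_tensor T).

(* <a, b, c> *)
Definition mm_tensor (a b c : nat) :
    tensor F ('I_a * 'I_b)%type ('I_b * 'I_c)%type ('I_c * 'I_a)%type :=
  [ffun v => let: (x, y, z) := v in
     [&& x.2 == y.1, y.2 == z.1 & z.2 == x.1]%:R].

(* The substitution is x := \sum_x' f x x' * x', with f x x' a polynomial in
   the formal variable, and likewise for g and h. *)
Definition subst_coef (X1 Y1 Z1 X2 Y2 Z2 : finType) (T : tensor F X1 Y1 Z1)
    (f : X1 -> X2 -> {poly F}) (g : Y1 -> Y2 -> {poly F})
    (h : Z1 -> Z2 -> {poly F}) (x' : X2) (y' : Y2) (z' : Z2) : {poly F} :=
  \sum_x \sum_y \sum_z (T (x, y, z))%:P * (f x x' * g y y' * h z z').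

Definition degenerates (X1 Y1 Z1 X2 Y2 Z2 : finType)
    (T1 : tensor F X1 Y1 Z1) (T2 : tensor F X2 Y2 Z2) : Prop :=
  exists (f : X1 -> X2 -> {poly F}) (g : Y1 -> Y2 -> {poly F})
         (h : Z1 -> Z2 -> {poly F}) (e : nat),
    forall x y z,
      (subst_coef T1 f g h x y z)`_e = T2 (x, y, z) /\
      forall d, (d < e)%N -> (subst_coef T1 f g h x y z)`_d = 0.

Section SliceRank.
Variables X Y Z : finType.
Implicit Type T : tensor F X Y Z.

Definition x_rank1 T : Prop :=
  exists (a : X -> F) (b : Y -> Z -> F), forall x y z, T (x, y, z) = a x * b y z.
Definition y_rank1 T : Prop :=
  exists (a : Y -> F) (b : X -> Z -> F), forall x y z, T (x, y, z) = a y * b x z.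
Definition z_rank1 T : Prop :=
  exists (a : Z -> F) (b : X -> Y -> F), forall x y z, T (x, y, z) = a z * b x y.

Definition sum_of (P : tensor F X Y Z -> Prop) T (r : nat) : Prop :=
  exists A : 'I_r -> {ffun X * Y * Z -> F}, (forall i, P (A i)) /\ T = \sum_i A i.

Definition x_rank T : nat := least (sum_of x_rank1 T).
Definition y_rank T : nat := least (sum_of y_rank1 T).
Definition z_rank T : nat := least (sum_of z_rank1 T).

Definition slice_rank T : nat :=
  least (fun s => exists TX TY TZ : {ffun X * Y * Z -> F},
    T = TX + TY + TZ /\ s = (x_rank TX + y_rank TY + z_rank TZ)%N).

Lemma ex_sum_of_x T : exists r, sum_of x_rank1 T r.
Proof.
exists #|X|, (fun i => [ffun v => (v.1.1 == enum_val i)%:R * T v]); split.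
  move=> i; exists (fun x => (x == enum_val i)%:R).
  exists (fun y z => T (enum_val i, y, z)) => x y z; rewrite ffunE /=.
  by case: eqP => [->//|_]; rewrite !mul0r.
apply/ffunP => -[[x y] z]; rewrite sum_ffunE (bigD1 (enum_rank x)) //= ffunE.
rewrite enum_rankK eqxx mul1r big1 ?addr0// => i ni; rewrite ffunE /=.
by case: eqP => [xi|_]; rewrite ?mul0r// xi enum_valK eqxx in ni *.
Qed.

Lemma ex_sum_of_y T : exists r, sum_of y_rank1 T r.
Proof.
exists #|Y|, (fun i => [ffun v => (v.1.2 == enum_val i)%:R * T v]); split.
  move=> i; exists (fun y => (y == enum_val i)%:R).
  exists (fun x z => T (x, enum_val i, z)) => x y z; rewrite ffunE /=.
  by case: eqP => [->//|_]; rewrite !mul0r.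
apply/ffunP => -[[x y] z]; rewrite sum_ffunE (bigD1 (enum_rank y)) //= ffunE.
rewrite enum_rankK eqxx mul1r big1 ?addr0// => i ni; rewrite ffunE /=.
by case: eqP => [yi|_]; rewrite ?mul0r// yi enum_valK eqxx in ni *.
Qed.

Lemma ex_sum_of_z T : exists r, sum_of z_rank1 T r.
Proof.
exists #|Z|, (fun i => [ffun v => (v.2 == enum_val i)%:R * T v]); split.
  move=> i; exists (fun z => (z == enum_val i)%:R).
  exists (fun x y => T (x, y, enum_val i)) => x y z; rewrite ffunE /=.
  by case: eqP => [->//|_]; rewrite !mul0r.
apply/ffunP => -[[x y] z]; rewrite sum_ffunE (bigD1 (enum_rank z)) //= ffunE.
rewrite enum_rankK eqxx mul1r big1 ?addr0// => i ni; rewrite ffunE /=.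
by case: eqP => [zi|_]; rewrite ?mul0r// zi enum_valK eqxx in ni *.
Qed.

Lemma ex_slice_rank T : exists s, exists TX TY TZ : {ffun X * Y * Z -> F},
  T = TX + TY + TZ /\ s = (x_rank TX + y_rank TY + z_rank TZ)%N.
Proof. by eexists; exists T, 0, 0; rewrite !addr0; split. Qed.

End SliceRank.

(* The n-th power has one variable for each n-tuple of variables of T. *)
Definition tensor_pow (X Y Z : finType) (T : tensor F X Y Z) (n : nat) :
    tensor F {ffun 'I_n -> X} {ffun 'I_n -> Y} {ffun 'I_n -> Z} :=
  [ffun v : {ffun 'I_n -> X} * {ffun 'I_n -> Y} * {ffun 'I_n -> Z} =>
     \prod_(i < n) T (v.1.1 i, v.1.2 i, v.2 i)].

(* The term n = 0 is irrelevant to the limsup. *)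
Definition asymp_slice_rank (R : realType) (X Y Z : finType)
    (T : tensor F X Y Z) : R :=
  limn_sup (fun n => powR (slice_rank (tensor_pow T n))%:R (n%:R^-1) : R).

(* A partition of X into k parts is an indexed family of sets such that every
   variable is in exactly one of them; parts may be empty. *)
Definition is_partition (X : finType) (k : nat) (P : 'I_k -> {set X}) : Prop :=
  forall x, exists! i, x \in P i.

Section Partitioned.
Variables (X Y Z : finType) (k : nat).
Variable T : tensor F X Y Z.
Variables (PX : 'I_k -> {set X}) (PY : 'I_k -> {set Y}) (PZ : 'I_k -> {set Z}).

(* T_ijl, as a tensor over the variable sets X_i, Y_j, Z_l. *)
Definition block (i j l : 'I_k) :
    tensor F {x | x \in PX i} {y | y \in PY j} {z | z \in PZ l} :=
  [ffun v => T (val v.1.1, val v.1.2, val v.2)].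

Definition block_nonzero (i j l : 'I_k) : bool :=
  (block i j l : {ffun _ -> F}) != 0.

Definition parts_symmetric : Prop :=
  (forall i, #|PX i| = #|PY i| /\ #|PY i| = #|PZ i|) /\
  (forall i j l, tensor_eq (block j l i) (rot_tensor (block i j l))).

(* Parts are numbered from 1, hence the successors. *)
Definition laser_ready : Prop :=
  [/\ forall i j l, block_nonzero i j l ->
        exists a b c : nat,
          [/\ degenerates (block i j l) (mm_tensor a b c),
              (a * b)%N = #|PX i|, (b * c)%N = #|PY j|
            & (c * a)%N = #|PZ l|],
      exists ell : int, forall i j l, block_nonzero i j l ->
        (i.+1 + j.+1 + l.+1)%N%:Z = ell,
      variable_symmetric T
    & parts_symmetric].

Section Distributions.
Variable R : realType.

(* The elements of L are represented by their indices, and a distribution on L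
   is extended by zero to all triples of indices. *)
Definition sym_distr (p : {ffun 'I_k * 'I_k * 'I_k -> R}) : Prop :=
  [/\ forall t, 0 <= p t,
      \sum_t p t = 1,
      forall i j l, ~~ block_nonzero i j l -> p (i, j, l) = 0
    & forall i j l, p (i, j, l) = p (j, l, i)].

Definition marginalX (p : {ffun 'I_k * 'I_k * 'I_k -> R}) (i : 'I_k) : R :=
  \sum_j \sum_(l | block_nonzero i j l) p (i, j, l).

(* A factor whose marginal is 0 is 1, since [powR a 0 = 1] for every a. *)
Definition p_X (p : {ffun 'I_k * 'I_k * 'I_k -> R}) : R :=
  \prod_i powR (#|PX i|%:R / marginalX p i) (marginalX p i).

End Distributions.
End Partitioned.
End Tensors.

Arguments asymp_slice_rank {F} R {X Y Z} T.

(* Main.v *)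
Require Import Defs.
From mathcomp Require Import all_boot all_order all_algebra.
From mathcomp Require Import all_classical all_reals all_analysis.
From mathcomp Require Import zify ring lra.

(** If T has slice rank r, it vanishes on a product of three subspaces whose
    codimensions add up to at most r.  Taking leading terms for the grading of
    T^n by block sequences, tightness makes every block (I, J, K) of T^n vanish
    on the corresponding graded pieces, of codimensions c_I, c_J, c_K; the sum of
    all these codimensions is again at most r.  A nonzero block degenerates to
    some <a,b,c>, and the same leading-term argument, for the degeneration and
    then for the tight tensor <a,b,c>, gives
    c_I / |X_I| + c_J / |Y_J| + c_K / |Z_K| >= 1.
    Averaging over p^n for p in P^sym(L), a Chernoff bound turns this into
    r >= W^n / 2 for every W < p_X and n large, with no need for disjoint blocks.

    Conversely, by concave duality a nearly optimal p gives weights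
    v_i = ln (|X_i| / p(X_i)) with v_i + v_j + v_l <= 3 c on L, where c is as
    close to ln (sup p_X) as desired.  The x-, y- and z-variables of T^n of total
    weight at most c n then cover the support of T^n, and there are at most
    exp (c n) of each kind. *)

Set Implicit Arguments.
Unset Strict Implicit.
Unset Printing Implicit Defensive.
Import Order.TTheory GRing.Theory Num.Theory.
Import numFieldNormedType.Exports.
Local Open Scope ring_scope.

(** * Isotropic subspaces and degeneration *)

Section Kernels.
Variable F : fieldType.

(** Dividing by the largest power of the variable common to all entries leaves an entry that is
    nonzero at 0: the pivot needed in [lift_kernel]. *)
Lemma poly_col_factor n (b : 'cV[{poly F}]_n) : b != 0 ->
  exists v i0 (b' : 'cV[{poly F}]_n), b = 'X^v *: b' /\ (b' i0 0)`_0 != 0.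
Proof.
move=> b0; have exv : exists v, [exists i, (b i 0)`_v != 0].
  have [i bi0] : exists i, b i 0 != 0.
    apply/existsP; apply: contraNT b0; rewrite negb_exists => /forallP bz.
    by apply/eqP/colP => i; rewrite mxE; apply/eqP; have := bz i; rewrite negbK.
  exists (size (b i 0)).-1; apply/existsP; exists i.
  by rewrite -lead_coefE lead_coef_eq0.
case: (ex_minnP exv) => v /existsP[i0 bv] vmin.
exists v, i0, (\col_i drop_poly v (b i 0)); split; last first.
  by rewrite mxE coef_drop_poly.
apply/colP => i; rewrite !mxE -[LHS](poly_take_drop v) mulrC.
suff -> : take_poly v (b i 0) = 0 by rewrite add0r.
apply/polyP => d; rewrite coef_take_poly coef0; case: ifP => // dv.
apply/eqP; apply: contraLR dv => bd; rewrite -leqNgt; apply: vmin.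
by apply/existsP; exists i.
Qed.

(* Semicontinuity of the rank at 0: the kernel of a matrix of polynomials has a
   specialization of the generic dimension. *)
Lemma lift_kernel n c (C : 'M[{poly F}]_(n, c)) :
  exists L : 'M[{poly F}]_n,
    L *m C = 0 /\ (n <= \rank (map_mx (horner_eval 0) L) + c)%N.
Proof.
elim: c C => [|c IHc]; [move=> C | rewrite -[c.+1]/(1 + c)%N => C].
  exists 1%:M; split; first by apply/matrixP => i [].
  by rewrite map_mx1 mxrank1 addn0.
have [L [LC rL]] := IHc (rsubmx C).
have [b0|/poly_col_factor[v [i0 [b [bE bi0]]]]] := eqVneq (L *m lsubmx C) 0.
  exists L; split; last by lia.
  by rewrite -[C]hsubmxK mul_mx_row LC b0 row_mx0.
(* The column not yet killed is ['X^v *: b]. Eliminating with row [i0] after dropping ['X^v] keeps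
   the pivot nonzero at 0, so at 0 the matrix only changes by a nonzero factor and a matrix of rank
   at most one: each column costs at most one dimension. *)
exists (b i0 0 *: L - b *m row i0 L); split.
  rewrite -[C]hsubmxK mul_mx_row !mulmxBl -!scalemxAl -!mulmxA -!row_mul LC bE.
  rewrite scaler0 row0 mulmx0 subrr -[RHS]row_mx0; congr row_mx.
  apply/matrixP => i j; rewrite !mxE big_ord1 !mxE !ord1; ring.
set L' := _ - _.
have L0E : map_mx (horner_eval 0) L = ((b i0 0)`_0)^-1 *:
    (map_mx (horner_eval 0) L' + map_mx (horner_eval 0) (b *m row i0 L)).
  rewrite -map_mxD subrK map_mxZ scalerA -horner_coef0 [X in X *: _]mulVf.
    by rewrite scale1r.
  by rewrite horner_coef0.
have rL' : (\rank (map_mx (horner_eval 0) L) <=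
    \rank (map_mx (horner_eval 0) L') +
    \rank (map_mx (horner_eval 0) (b *m row i0 L)))%N.
  by rewrite L0E mxrank_scale_nz ?invr_eq0// mxrank_add.
have rb : (\rank (map_mx (horner_eval (0 : F)) (b *m row i0 L)) <= 1)%N.
  by rewrite map_mxM (leq_trans (mxrankM_maxl _ _))// rank_leq_col.
apply: leq_trans rL _; rewrite addnA leq_add2r.
by apply: leq_trans rL' _; rewrite leq_add2l.
Qed.

End Kernels.

Section Vectors.
Variable F : fieldType.

(* Row vectors over a finite type: the coordinate of [u] at [x] is
   [u 0 (enum_rank x)]. *)
Definition triform (X Y Z : finType) (T : X -> Y -> Z -> F)
    (u : 'rV[F]_#|X|) (v : 'rV[F]_#|Y|) (w : 'rV[F]_#|Z|) : F :=
  \sum_x \sum_y \sum_z T x y z *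
    (u 0 (enum_rank x) * v 0 (enum_rank y) * w 0 (enum_rank z)).

Definition isotropic (X Y Z : finType) (T : tensor F X Y Z)
    (U : 'M[F]_#|X|) (V : 'M[F]_#|Y|) (W : 'M[F]_#|Z|) : Prop :=
  forall u v w, (u <= U)%MS -> (v <= V)%MS -> (w <= W)%MS ->
    triform (fun x y z => T (x, y, z)) u v w = 0.

Definition coord_proj (X : finType) (A : {set X}) : 'M[F]_#|X| :=
  \matrix_(i, j) ((i == j) && (enum_val i \in A))%:R.

Lemma mul_coord_proj (X : finType) (A : {set X}) (u : 'rV[F]_#|X|) x :
  (u *m coord_proj A) 0 (enum_rank x) =
    if x \in A then u 0 (enum_rank x) else 0.
Proof.
rewrite !mxE (bigD1 (enum_rank x))//= !mxE eqxx enum_rankK big1 ?addr0.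
  by case: (x \in A); rewrite ?mulr1 ?mulr0.
by move=> i /negbTE ni; rewrite mxE ni mulr0.
Qed.

Lemma row_fintypeP (R : Type) (X : finType) (u v : 'rV[R]_#|X|) :
  (forall x, u 0 (enum_rank x) = v 0 (enum_rank x)) -> u = v.
Proof. by move=> uv; apply/rowP => i; rewrite -[i]enum_valK. Qed.

Lemma sub_coord_projP (X : finType) (A : {set X}) (u : 'rV[F]_#|X|) :
  (u <= coord_proj A)%MS <-> forall x, x \notin A -> u 0 (enum_rank x) = 0.
Proof.
split=> [/submxP[D ->] x /negbTE xA|uA].
  by rewrite mul_coord_proj xA.
suff <- : u *m coord_proj A = u by apply: submxMl.
apply: row_fintypeP => x; rewrite mul_coord_proj.
by case: ifPn => // /uA.
Qed.

Lemma coord_proj_id (X : finType) (A : {set X}) (u : 'rV[F]_#|X|) :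
  (forall x, x \notin A -> u 0 (enum_rank x) = 0) -> u *m coord_proj A = u.
Proof.
move=> uA; apply: row_fintypeP => x; rewrite mul_coord_proj.
by case: ifPn => // /uA.
Qed.

Lemma rank_coord_proj (X : finType) (A : {set X}) :
  (\rank (coord_proj A) <= #|A|)%N.
Proof.
pose M : 'M[F]_(#|X|, #|A|) := \matrix_(i, j) (enum_val i == enum_val j)%:R.
suff -> : coord_proj A = M *m M^T.
  by apply: leq_trans (mxrankM_maxl _ _) (rank_leq_col _).
apply/matrixP => i j; rewrite !mxE.
have [iA|iA] := boolP (enum_val i \in A); last first.
  rewrite andbF big1// => l _; rewrite !mxE.
  have [il|] := eqVneq (enum_val i) (enum_val l); last by rewrite mul0r.
  by rewrite il enum_valP in iA.
rewrite (bigD1 (enum_rank_in iA (enum_val i)))//= !mxE enum_rankK_in// eqxx mul1r.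
rewrite big1 ?addr0 => [|l]; last first.
  move=> /negbTE li; rewrite !mxE.
  have [il|] := eqVneq (enum_val i) (enum_val l); last by rewrite mul0r.
  by move: li; rewrite -(inj_eq enum_val_inj) enum_rankK_in// il eqxx.
by rewrite andbT (inj_eq enum_val_inj) eq_sym.
Qed.

(** Since [f] is supported on [A], having image in [U] amounts to at most [#|A| - \rank U] linear
    conditions on a polynomial vector. [lift_kernel] solves them over polynomials, and [W] collects
    the values at 0 of solutions. *)
Lemma pull_subspace (X X' : finType) (A : {set X}) (U : 'M[F]_#|X|)
    (f : X -> X' -> {poly F}) :
  (U <= coord_proj A)%MS -> (forall x x', x \notin A -> f x x' = 0) ->
  exists W : 'M[F]_#|X'|, (#|X'| + \rank U <= \rank W + #|A|)%N /\
    forall w : 'rV_#|X'|, (w <= W)%MS -> exists wt : 'rV[{poly F}]_#|X'|,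
      (forall x', (wt 0 (enum_rank x'))`_0 = w 0 (enum_rank x')) /\
      forall d, (\row_(i < #|X|) (\sum_x' wt 0 (enum_rank x') * f (enum_val i) x')`_d
                  <= U)%MS.
Proof.
(* The columns of [K] are independent equations that cut out [U] inside the coordinate space of
   [A]. *)
move=> UA fA; pose K := col_base (coord_proj A *m cokermx U).
have rK : (\rank (coord_proj A *m cokermx U) + \rank U <= #|A|)%N.
  apply: leq_trans (rank_coord_proj A).
  rewrite -(mxrank_mul_ker (coord_proj A) (cokermx U)) leq_add2l mxrankS//.
  by rewrite sub_capmx UA sub_kermx mulmx_coker eqxx.
pose fm : 'M[{poly F}]_(#|X'|, #|X|) := \matrix_(i, j) f (enum_val j) (enum_val i).
have [L [LC rL]] := lift_kernel (fm *m map_mx polyC K).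
exists (map_mx (horner_eval 0) L); split; first by lia.
move=> w /submxP[D ->]; exists (map_mx polyC D *m L); split=> [x'|d].
  rewrite -horner_coef0 -/(horner_eval 0 _).
  have {2}-> : D = map_mx (horner_eval 0) (map_mx polyC D).
    by apply/matrixP => i j; rewrite !mxE /horner_eval hornerC.
  by rewrite -map_mxM [RHS]mxE.
set u := \row_i _.
have uE : u = map_mx (coefp d) (map_mx polyC D *m L *m fm).
  apply/rowP => i; rewrite !mxE /=; congr (nth 0 (polyseq _) d).
  rewrite (reindex enum_rank)/=; last first.
    by exists enum_val => ? _; rewrite ?enum_rankK ?enum_valK.
  by apply: eq_bigr => x' _; rewrite !mxE enum_rankK.
have uA x : x \notin A -> u 0 (enum_rank x) = 0.
  move=> xA; rewrite mxE enum_rankK big1 ?coef0// => x' _.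
  by rewrite fA// mulr0.
rewrite submxE -(coord_proj_id uA) -mulmxA -[coord_proj A *m _]mulmx_base mulmxA.
suff -> : u *m K = 0 by rewrite mul0mx.
have <- : map_mx (coefp d) ((map_mx polyC D *m L *m fm) *m map_mx polyC K)
     = u *m K.
  apply/matrixP => i j; rewrite uE !mxE /= coef_sum; apply: eq_bigr => l _.
  by rewrite !mxE coefMC.
by rewrite -!mulmxA LC mulmx0; apply/matrixP => i j; rewrite !mxE /= coef0.
Qed.

(** Degeneration does not increase codimensions. Vectors of the new spaces lift to polynomial
    vectors whose images have all their coefficients in [U], [V], [W]; the form of [T] vanishes on
    these images, and its coefficient of order [e] is the value of [G]. *)
Lemma degenerate_isotropic (X Y Z X' Y' Z' : finType) (T : tensor F X Y Z)
    (G : tensor F X' Y' Z') (f : X -> X' -> {poly F}) (g : Y -> Y' -> {poly F})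
    (h : Z -> Z' -> {poly F}) (e : nat) (A : {set X}) (B : {set Y}) (C : {set Z})
    (U : 'M[F]_#|X|) (V : 'M[F]_#|Y|) (W : 'M[F]_#|Z|) :
  (forall x y z, (subst_coef T f g h x y z)`_e = G (x, y, z) /\
      forall d, (d < e)%N -> (subst_coef T f g h x y z)`_d = 0) ->
  (forall x x', x \notin A -> f x x' = 0) ->
  (forall y y', y \notin B -> g y y' = 0) ->
  (forall z z', z \notin C -> h z z' = 0) ->
  (U <= coord_proj A)%MS -> (V <= coord_proj B)%MS -> (W <= coord_proj C)%MS ->
  isotropic T U V W ->
  exists U' V' W', [/\ isotropic G U' V' W',
    (#|X'| + \rank U <= \rank U' + #|A|)%N,
    (#|Y'| + \rank V <= \rank V' + #|B|)%N
    & (#|Z'| + \rank W <= \rank W' + #|C|)%N].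
Proof.
move=> degG fA gB hC UA VB WC iso.
have [U' [rU' liftU]] := pull_subspace UA fA.
have [V' [rV' liftV]] := pull_subspace VB gB.
have [W' [rW' liftW]] := pull_subspace WC hC.
exists U', V', W'; split=> // u v w /liftU[ut [ut0 utU]].
move=> /liftV[vt [vt0 vtV]] /liftW[wt [wt0 wtW]].
pose fu x := \sum_x' ut 0 (enum_rank x') * f x x'.
pose gv y := \sum_y' vt 0 (enum_rank y') * g y y'.
pose hw z := \sum_z' wt 0 (enum_rank z') * h z z'.
(* Each coefficient of this polynomial is a sum of values of [T] on vectors of [U], [V], [W]. *)
have Sz : \sum_x \sum_y \sum_z (T (x, y, z))%:P * (fu x * gv y * hw z) = 0.
  apply/polyP => d; rewrite coef0 coef_sum.
  under eq_bigr => x _ do rewrite coef_sum.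
  under eq_bigr => x _ do under eq_bigr => y _ do rewrite coef_sum.
  have -> : \sum_x \sum_y \sum_z ((T (x, y, z))%:P * (fu x * gv y * hw z))`_d =
     \sum_(a < d.+1) \sum_(b < a.+1) triform (fun x y z => T (x, y, z))
       (\row_i (fu (enum_val i))`_b) (\row_i (gv (enum_val i))`_(a - b))
       (\row_i (hw (enum_val i))`_(d - a)).
    rewrite /triform.
    under [RHS]eq_bigr => a _ do rewrite exchange_big.
    rewrite [RHS]exchange_big; apply: eq_bigr => x _ /=.
    under [RHS]eq_bigr => a _ do rewrite exchange_big.
    rewrite [RHS]exchange_big; apply: eq_bigr => y _ /=.
    under [RHS]eq_bigr => a _ do rewrite exchange_big.
    rewrite [RHS]exchange_big; apply: eq_bigr => z _ /=.
    rewrite coefCM coefM mulr_sumr; apply: eq_bigr => a _.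
    rewrite coefM mulr_suml mulr_sumr; apply: eq_bigr => b _.
    by rewrite !mxE !enum_rankK.
  by rewrite big1 // => a _; rewrite big1// => b _; apply: iso.
have Se : \sum_x' \sum_y' \sum_z' subst_coef T f g h x' y' z' *
   (ut 0 (enum_rank x') * vt 0 (enum_rank y') * wt 0 (enum_rank z')) = 0.
  rewrite -[RHS]Sz /subst_coef.
  under eq_bigr => x' _ do under eq_bigr => y' _ do under eq_bigr => z' _ do
    rewrite mulr_suml.
  under eq_bigr => x' _ do under eq_bigr => y' _ do rewrite exchange_big.
  under eq_bigr => x' _ do rewrite exchange_big.
  rewrite exchange_big; apply: eq_bigr => x _ /=.
  under eq_bigr => x' _ do under eq_bigr => y' _ do under eq_bigr => z' _ do
    rewrite mulr_suml.
  under eq_bigr => x' _ do under eq_bigr => y' _ do rewrite exchange_big.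
  under eq_bigr => x' _ do rewrite exchange_big.
  rewrite exchange_big; apply: eq_bigr => y _ /=.
  under eq_bigr => x' _ do under eq_bigr => y' _ do under eq_bigr => z' _ do
    rewrite mulr_suml.
  under eq_bigr => x' _ do under eq_bigr => y' _ do rewrite exchange_big.
  under eq_bigr => x' _ do rewrite exchange_big.
  rewrite exchange_big; apply: eq_bigr => z _ /=.
  rewrite {1}/fu !mulr_suml mulr_sumr; apply: eq_bigr => x' _.
  rewrite {1}/gv mulr_sumr mulr_suml mulr_sumr; apply: eq_bigr => y' _.
  rewrite /hw !mulr_sumr; apply: eq_bigr => z' _.
  ring.
have := congr1 (fun p : {poly F} => p`_e) Se; rewrite coef0 => <-.
rewrite /triform coef_sum; apply: eq_bigr => x' _.
rewrite coef_sum; apply: eq_bigr => y' _.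
rewrite coef_sum; apply: eq_bigr => z' _.
have [<- lo] := degG x' y' z'.
(* The substituted tensor has no coefficients below [e], so its coefficient [e] meets only the
   constant terms of the lifts. *)
rewrite coefM big_ord_recr/= big1 => [|i _]; last by rewrite lo ?mul0r.
rewrite add0r subnn -ut0 -vt0 -wt0.
by rewrite -!horner_coef0 !hornerM.
Qed.

End Vectors.

(** * Leading terms and slice rank *)

Section Graded.
Variable F : fieldType.

Section Filtration.
Variables (X : finType) (d : X -> nat).

Definition level (e : nat) : {set X} := [set x | d x == e].

(* Vectors of [V] supported in degrees at least [e]. *)
Fixpoint filtered (V : 'M[F]_#|X|) (e : nat) : 'M[F]_#|X| :=
  if e is e'.+1 then
    (filtered V e' :&: kermx (coord_proj F (level e')))%MS
  else V.

(** The degree [e] piece of the associated graded space: leading components, meaning those of lowest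
    degree. *)
Definition graded (V : 'M[F]_#|X|) (e : nat) : 'M[F]_#|X| :=
  filtered V e *m coord_proj F (level e).

(** The subtraction never truncates, by [rank_graded_le]. *)
Definition codim (V : 'M[F]_#|X|) (e : nat) : nat :=
  (#|level e| - \rank (graded V e))%N.

Lemma filtered_support (V : 'M[F]_#|X|) e (u : 'rV[F]_#|X|) :
  (u <= filtered V e)%MS ->
  (u <= V)%MS /\ forall x, (d x < e)%N -> u 0 (enum_rank x) = 0.
Proof.
elim: e => [|e IHe] //=; rewrite sub_capmx => /andP[/IHe[uV u0]].
move=> /sub_kermxP uP; split=> // x; rewrite ltnS leq_eqVlt => /predU1P[dx|/u0//].
by have := mul_coord_proj (level e) u x; rewrite uP inE dx eqxx mxE.
Qed.

Lemma rank_filtered (V : 'M[F]_#|X|) D :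
  (\rank V = \sum_(e < D) \rank (graded V e) + \rank (filtered V D))%N.
Proof.
elim: D => [|D IHD]; first by rewrite big_ord0.
by rewrite big_ord_recr /= -addnA mxrank_mul_ker.
Qed.

Lemma rank_graded_le (V : 'M[F]_#|X|) e : (\rank (graded V e) <= #|level e|)%N.
Proof. exact: leq_trans (mxrankM_maxr _ _) (rank_coord_proj _ _). Qed.

Lemma graded_sub (V : 'M[F]_#|X|) e :
  (graded V e <= coord_proj F (level e))%MS.
Proof. exact: submxMl. Qed.

Lemma sum_codim (V : 'M[F]_#|X|) (D : nat) : (forall x, d x < D)%N ->
  (\sum_(e < D) codim V e + \rank V)%N = #|X|.
Proof.
move=> dD; have -> : \rank V = (\sum_(e < D) \rank (graded V e))%N.
  rewrite (rank_filtered V D).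
  suff -> : filtered V D = 0 by rewrite mxrank0 addn0.
  apply/row_matrixP => i; rewrite row0.
  have [_ u0] := filtered_support (row_sub i (filtered V D)).
  by apply: row_fintypeP => x; rewrite u0 ?mxE.
rewrite -big_split/= -[RHS]sum1_card (partition_big (fun x => Ordinal (dD x)) xpredT)//=.
apply: eq_bigr => e _; rewrite subnK ?rank_graded_le//.
by rewrite -sum1_card; apply: eq_bigl => x; rewrite inE.
Qed.

(** Over all levels the codimensions add up to that of [V], and an injection lists each level at
    most once. *)
Lemma sum_codim_inj (I : finType) (r : I -> nat) (V : 'M[F]_#|X|) :
  injective r -> (\sum_i codim V (r i) + \rank V <= #|X|)%N.
Proof.
move=> rI; pose D := (\max_i (r i) + \max_x (d x)).+1.
have rD i : (r i < D)%N by rewrite ltnS (leq_trans (leq_bigmax i))// leq_addr.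
have dD x : (d x < D)%N by rewrite ltnS (leq_trans (leq_bigmax x))// leq_addl.
rewrite -[leqRHS](sum_codim V dD) leq_add2r.
rewrite (bigID (mem [set Ordinal (rD i) | i : I]))/=.
rewrite big_imset/= => [|i j _ _ [/rI//]].
by rewrite big_mkcond/= (eq_bigr (fun i => codim V (r i))) ?leq_addr.
Qed.

End Filtration.

(** Replacing each leading component by a vector it comes from does not change the form: every term
    has total degree [l], so a term exceeding its threshold in one variable falls below it in
    another, where the vector vanishes. *)
Lemma graded_isotropic (X Y Z : finType) (T : tensor F X Y Z) (dX : X -> nat)
    (dY : Y -> nat) (dZ : Z -> nat) (l e1 e2 e3 : nat)
    (U : 'M[F]_#|X|) (V : 'M[F]_#|Y|) (W : 'M[F]_#|Z|) :
  (forall x y z, T (x, y, z) != 0 -> (dX x + dY y + dZ z = l)%N) ->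
  (e1 + e2 + e3 = l)%N -> isotropic T U V W ->
  isotropic T (graded dX U e1) (graded dY V e2) (graded dZ W e3).
Proof.
move=> Tl el iso _ _ _ /submxP[u ->] /submxP[v ->] /submxP[w ->].
rewrite !mulmxA.
have /filtered_support[uU u0] := submxMl u (filtered dX U e1).
have /filtered_support[vV v0] := submxMl v (filtered dY V e2).
have /filtered_support[wW w0] := submxMl w (filtered dZ W e3).
rewrite -[RHS](iso _ _ _ uU vV wW) /triform.
apply: eq_bigr => x _; apply: eq_bigr => y _; apply: eq_bigr => z _.
have [->|/Tl dl] := eqVneq (T (x, y, z)) 0; first by rewrite !mul0r.
rewrite !mul_coord_proj !inE.
have [dx|dx|dx] := ltngtP (dX x) e1; first by rewrite u0 // !mul0r mulr0.
  have [dy|dy|dy] := ltngtP (dY y) e2; first by rewrite v0 // !(mulr0, mul0r).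
    have dz : (dZ z < e3)%N by lia.
    by rewrite w0 // !(mulr0, mul0r).
  have dz : (dZ z < e3)%N by lia.
  by rewrite w0 // !(mulr0, mul0r).
have [dy|dy|dy] := ltngtP (dY y) e2; first by rewrite v0 // !(mulr0, mul0r).
  have dz : (dZ z < e3)%N by lia.
  by rewrite w0 // !(mulr0, mul0r).
have -> : (dZ z == e3) by apply/eqP; lia.
by [].
Qed.

End Graded.

(** * Codimension inequality for matrix multiplication tensors *)

Section MatrixMultiplication.
Variable F : fieldType.

Lemma digits2_inj m a b a' b' : (a < m)%N -> (a' < m)%N ->
  (a + m * b = a' + m * b')%N -> a = a' /\ b = b'.
Proof.
move=> am am' E; have m0 : (0 < m)%N by lia.
have bE : b = b'.
  have := congr1 (divn^~ m) E.
  by rewrite /= ![(_ + m * _)%N]addnC ![(m * _)%N]mulnC !divnMDl// !divn_small// !addn0.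
by split=> //; move: E; rewrite bE; lia.
Qed.

(* The tensor <|A|, |B|, |C|>, with variables outside the three index sets
   occurring in no term. *)
Definition mm_on (J : finType) (A B C : {set J}) :
    tensor F (J * J)%type (J * J)%type (J * J)%type :=
  [ffun v => ([&& v.1.1.2 == v.1.2.1, v.1.2.2 == v.2.1, v.2.2 == v.1.1.1,
     v.1.1.1 \in A, v.1.2.1 \in B & v.2.1 \in C])%:R].

(** For injective [d] each level is a single variable, so codimension zero forces the graded piece
    to contain a nonzero multiple of its coordinate vector. *)
Lemma graded_delta (X : finType) (d : X -> nat) (V : 'M[F]_#|X|) x :
  injective d -> codim d V (d x) = 0%N ->
  exists u : 'rV[F]_#|X|, [/\ (u <= graded d V (d x))%MS,
    u 0 (enum_rank x) != 0 & forall x', x' != x -> u 0 (enum_rank x') = 0].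
Proof.
move=> dI c0; have lx : level d (d x) = [set x].
  by apply/setP => x'; rewrite !inE (inj_eq dI).
have gr0 : graded d V (d x) != 0.
  rewrite -mxrank_eq0 -lt0n; move: c0; rewrite /codim lx cards1; lia.
exists (nz_row (graded d V (d x))); have us := nz_row_sub (graded d V (d x)).
have /sub_coord_projP ux := submx_trans us (graded_sub _ _ _).
have u0 x' : x' != x -> nz_row (graded d V (d x)) 0 (enum_rank x') = 0.
  by move=> xx'; apply: ux; rewrite lx inE.
split=> //; apply: contra gr0; rewrite -nz_row_eq0 => /eqP uz.
apply/eqP/row_fintypeP => x'; rewrite mxE.
by have [->|/u0] := eqVneq x' x.
Qed.

(** An injective tight weighting reduces to single variables: in each term x_ij y_js z_si at least
    one variable has codimension one. Summing over all triples counts x_ij once for each s in [C],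
    and similarly for y and z. *)
Lemma mm_isotropic (J : finType) (A B C : {set J})
    (U V W : 'M[F]_#|{: J * J}|) :
  isotropic (mm_on A B C) U V W ->
  (#|A| * #|B| * #|C| <= #|C| * (#|{: J * J}| - \rank U)
     + #|A| * (#|{: J * J}| - \rank V) + #|B| * (#|{: J * J}| - \rank W))%N.
Proof.
move=> iso; pose m := #|J|.
have [r [rI rm]] : exists r : J -> nat, injective r /\ forall x, (r x < m)%N.
  exists (fun x => enum_rank x : nat).
  by split=> [i j /ord_inj/enum_rank_inj|x]; last exact: ltn_ord.
(* Each index enters one of its two variables with a plus sign and the other with a minus sign, at
   its own power of [m], so the weights of a term add up to a constant. The shifts by [m] keep them
   natural numbers. *)
pose dX (x : J * J) := (r x.1 + m * (m - r x.2))%N.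
pose dY (x : J * J) := (m * (r x.1 + m * (m - r x.2)))%N.
pose dZ (x : J * J) := ((m - r x.2) + m * (m * r x.1))%N.
have dXI : injective dX.
  move=> [i j] [i' j'] /digits2_inj[]; rewrite ?rm//= => ii jj.
  have := rm j; have := rm j' => rj rj'.
  by congr pair; apply: rI; lia.
have dYI : injective dY.
  move=> [i j] [i' j'] /eqP; rewrite eqn_mul2l => /orP[/eqP m0|/eqP].
    by have := rm i; rewrite m0.
  move=> /digits2_inj[]; rewrite ?rm//= => ii jj.
  have := rm j; have := rm j' => rj rj'.
  by congr pair; apply: rI; lia.
have dZI : injective dZ.
  move=> [i j] [i' j'] E; have := rm j; have := rm j' => rj rj'.
  have m0 : (0 < m)%N by lia.
  (* The low digit [m - r j] ranges over 1 to [m], so it is lowered by one before digits are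
     compared. *)
  have E' : (((m - r j).-1 + m * (m * r i)) =
         (m - r j').-1 + m * (m * r i'))%N.
    move: E; rewrite /dZ /=; lia.
  have [||jj ii] := digits2_inj _ _ E'; [lia|lia|].
  congr pair; apply: rI; last by lia.
  by move/eqP: ii; rewrite eqn_mul2l => /orP[/eqP m00|/eqP//]; lia.
pose l := (m + m * m + m * (m * m))%N.
have hom x y z : mm_on A B C (x, y, z) != 0 -> (dX x + dY y + dZ z = l)%N.
  case: x y z => [i j] [j' s] [s' i']; rewrite ffunE /=.
  have [->|] := eqVneq j j'; last by rewrite /= eqxx.
  have [->|] := eqVneq s s'; last by rewrite /= eqxx.
  have [->|] := eqVneq i' i; last by rewrite /= eqxx.
  move=> _; rewrite /dX /dY /dZ /l /=.
  have := rm i; have := rm j'; have := rm s' => /ltnW rs /ltnW rj /ltnW ri.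
  rewrite mulnDr !mulnBr; have := leq_mul (leqnn m) rj.
  have := leq_mul (leqnn m) (leq_mul (leqnn m) rs); lia.
pose cX x := codim dX U (dX x); pose cY y := codim dY V (dY y).
pose cZ z := codim dZ W (dZ z).
(* If all three codimensions were 0, the three coordinate vectors would lie in the graded pieces,
   and the form is nonzero on them. *)
have edge i j s : i \in A -> j \in B -> s \in C ->
    (1 <= cX (i, j) + cY (j, s) + cZ (s, i))%N.
  move=> iA jB sC; rewrite lt0n; apply/negP; rewrite !addn_eq0.
  move=> /andP[/andP[/eqP cx /eqP cy] /eqP cz].
  have [u [uU ux u0]] := graded_delta dXI cx.
  have [v [vV vx v0]] := graded_delta dYI cy.
  have [w [wW wx w0]] := graded_delta dZI cz.
  have ijs : mm_on A B C ((i, j), (j, s), (s, i)) = 1.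
    by rewrite ffunE /= !eqxx iA jB sC.
  have el := hom (i, j) (j, s) (s, i); rewrite ijs oner_eq0 in el.
  have := graded_isotropic hom (el isT) iso uU vV wW.
  rewrite /triform (bigD1 (i, j))//= [X in _ + X]big1 ?addr0; last first.
    by move=> x /u0 ->; rewrite big1// => y _; rewrite big1// => z _; rewrite !mul0r mulr0.
  rewrite (bigD1 (j, s))//= [X in _ + X]big1 ?addr0; last first.
    by move=> y /v0 ->; rewrite big1// => z _; rewrite mulr0 mul0r mulr0.
  rewrite (bigD1 (s, i))//= [X in _ + X]big1 ?addr0; last first.
    by move=> z /w0 ->; rewrite !mulr0.
  by rewrite ijs mul1r => /eqP; rewrite !mulf_eq0 (negbTE ux) (negbTE vx) (negbTE wx).
have sX : (\sum_x cX x <= #|{: J * J}| - \rank U)%N.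
  by rewrite -[leqLHS](addnK (\rank U)) leq_sub2r// sum_codim_inj.
have sY : (\sum_x cY x <= #|{: J * J}| - \rank V)%N.
  by rewrite -[leqLHS](addnK (\rank V)) leq_sub2r// sum_codim_inj.
have sZ : (\sum_x cZ x <= #|{: J * J}| - \rank W)%N.
  by rewrite -[leqLHS](addnK (\rank W)) leq_sub2r// sum_codim_inj.
have box (c : J * J -> nat) (P Q : {set J}) :
    (\sum_(i in P) \sum_(j in Q) c (i, j) <= \sum_x c x)%N.
  rewrite pair_big/= [leqRHS](bigID (fun x => (x.1 \in P) && (x.2 \in Q)))/=.
  by rewrite (eq_bigr c) ?leq_addr// => -[].
have -> : (#|A| * #|B| * #|C| = \sum_(i in A) \sum_(j in B) \sum_(s in C) 1)%N.
  rewrite sum1_card [X in (_ = \sum_(i in A) X)%N]sum_nat_const.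
  by rewrite sum_nat_const mulnA.
apply: leq_trans (_ : (\sum_(i in A) \sum_(j in B) \sum_(s in C)
   (cX (i, j) + cY (j, s) + cZ (s, i)) <= _)%N).
  by apply: leq_sum => i iA; apply: leq_sum => j jB; apply: leq_sum => s; apply: edge.
have -> : (\sum_(i in A) \sum_(j in B) \sum_(s in C)
   (cX (i, j) + cY (j, s) + cZ (s, i)) =
   #|C| * (\sum_(i in A) \sum_(j in B) cX (i, j)) +
   #|A| * (\sum_(j in B) \sum_(s in C) cY (j, s)) +
   #|B| * (\sum_(s in C) \sum_(i in A) cZ (s, i)))%N.
  under eq_bigr => i _ do under eq_bigr => j _ do rewrite !big_split/= sum_nat_const.
  under eq_bigr => i _ do rewrite !big_split/= -big_distrr/= sum_nat_const.
  rewrite !big_split/= sum_nat_const -!big_distrr/=.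
  by congr (_ + _ * _)%N; rewrite exchange_big.
by apply: leq_add; [apply: leq_add|]; rewrite leq_mul2l; apply/orP; right;
   apply: leq_trans (box _ _ _) _.
Qed.

End MatrixMultiplication.

(** * Slice rank, isotropic subspaces and coverings of the support *)

Section SliceRankBounds.
Variable F : fieldType.

Lemma annihilator_rank (X : finType) r (a : 'I_r -> X -> F) :
  exists U : 'M[F]_#|X|, (#|X| <= \rank U + r)%N /\
    forall u : 'rV_#|X|, (u <= U)%MS ->
      forall i, \sum_x a i x * u 0 (enum_rank x) = 0.
Proof.
pose M : 'M[F]_(#|X|, r) := \matrix_(j, i) a i (enum_val j).
exists (kermx M); rewrite mxrank_ker; split.
  by have := rank_leq_col M; have := rank_leq_row M; lia.
move=> u /sub_kermxP uM i; have := congr1 (fun v : 'rV_r => v 0 i) uM.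
rewrite !mxE (reindex enum_rank)/=; last first.
  by exists enum_val => ? _; rewrite ?enum_rankK ?enum_valK.
move=> E; rewrite -[RHS]E.
by apply: eq_bigr => x _; rewrite mxE enum_rankK mulrC.
Qed.

Lemma sum_slices_eq0 (X : finType) r (a : 'I_r -> X -> F) (b : 'I_r -> F)
    (u : X -> F) (c : F) :
  (forall i, \sum_x a i x * u x = 0) ->
  \sum_x (\sum_i a i x * b i) * (u x * c) = 0.
Proof.
move=> au; under eq_bigr => x _ do rewrite mulr_suml.
rewrite exchange_big big1//= => i _.
rewrite -[RHS](mul0r (b i * c)) -[X in _ = X * _](au i) mulr_suml.
by apply: eq_bigr => x _; ring.
Qed.

Section Ranks.
Variables (X Y Z : finType) (T : tensor F X Y Z).

Lemma x_rank_decomp : exists a b,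
  forall x y z, T (x, y, z) = \sum_(i < x_rank T) a i x * b i y z.
Proof.
have [[A [Ar AE]] _] := leastP (ex_sum_of_x T).
have [a aP] := choice Ar; have [b bP] := choice aP.
exists a, b => x y z; rewrite [LHS](congr1 (fun t : tensor F X Y Z => t (x, y, z)) AE) sum_ffunE.
by apply: eq_bigr => i _; exact: bP.
Qed.

Lemma y_rank_decomp : exists a b,
  forall x y z, T (x, y, z) = \sum_(i < y_rank T) a i y * b i x z.
Proof.
have [[A [Ar AE]] _] := leastP (ex_sum_of_y T).
have [a aP] := choice Ar; have [b bP] := choice aP.
exists a, b => x y z; rewrite [LHS](congr1 (fun t : tensor F X Y Z => t (x, y, z)) AE) sum_ffunE.
by apply: eq_bigr => i _; exact: bP.
Qed.

Lemma z_rank_decomp : exists a b,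
  forall x y z, T (x, y, z) = \sum_(i < z_rank T) a i z * b i x y.
Proof.
have [[A [Ar AE]] _] := leastP (ex_sum_of_z T).
have [a aP] := choice Ar; have [b bP] := choice aP.
exists a, b => x y z; rewrite [LHS](congr1 (fun t : tensor F X Y Z => t (x, y, z)) AE) sum_ffunE.
by apply: eq_bigr => i _; exact: bP.
Qed.

End Ranks.

(** The three spaces are the common kernels of the x-, y- and z-factors of an optimal decomposition.
    Each slice costs at most one dimension and vanishes on the kernel of its own factor. *)
Lemma slice_rank_isotropic (X Y Z : finType) (T : tensor F X Y Z) :
  exists U V W, isotropic T U V W /\
   (#|X| - \rank U + (#|Y| - \rank V) + (#|Z| - \rank W) <= slice_rank T)%N.
Proof.
have [[TX [TY [TZ [TE rE]]]] _] := leastP (ex_slice_rank T).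
have [a [a' aE]] := x_rank_decomp TX.
have [b [b' bE]] := y_rank_decomp TY.
have [c [c' cE]] := z_rank_decomp TZ.
have [U [rU aU]] := annihilator_rank a.
have [V [rV bV]] := annihilator_rank b.
have [W [rW cW]] := annihilator_rank c.
exists U, V, W; split; last by rewrite /slice_rank rE; lia.
move=> u v w uU vV wW; rewrite /triform.
have TxyzE x y z : T (x, y, z) = TX (x, y, z) + TY (x, y, z) + TZ (x, y, z).
  by rewrite [LHS](congr1 (fun t : tensor F X Y Z => t (x, y, z)) TE) !ffunE.
under eq_bigr => x _ do under eq_bigr => y _ do under eq_bigr => z _ do
  rewrite TxyzE !mulrDl.
under eq_bigr => x _ do under eq_bigr => y _ do rewrite !big_split/=.
under eq_bigr => x _ do rewrite !big_split/=.
rewrite !big_split/= [X in X + _ + _]exchange_big /=.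
under eq_bigr => y _ do rewrite exchange_big.
rewrite big1 => [|y _]; last first.
  rewrite big1// => z _.
  under eq_bigr => x _ do rewrite aE -[_ * _ * w _ _]mulrA.
  exact: sum_slices_eq0 (aU _ uU).
rewrite add0r [X in X + _]big1 => [|x _]; last first.
  rewrite exchange_big big1//= => z _.
  under eq_bigr => y _ do
    rewrite bE [_ * v _ _]mulrC -[_ * _ * w _ _]mulrA.
  exact: sum_slices_eq0 (bV _ vV).
rewrite add0r big1// => x _; rewrite big1// => y _.
under eq_bigr => z _ do rewrite cE [_ * w _ _]mulrC.
exact: sum_slices_eq0 (cW _ wW).
Qed.

Lemma x_rank_le (X Y Z : finType) (T : tensor F X Y Z) (A : {set X}) :
  (forall x y z, x \notin A -> T (x, y, z) = 0) -> (x_rank T <= #|A|)%N.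
Proof.
move=> TA; apply: (proj2 (leastP (ex_sum_of_x T))).
exists (fun i => [ffun v => (v.1.1 == enum_val i)%:R * T v]); split.
  move=> i; exists (fun x => (x == enum_val i)%:R).
  exists (fun y z => T (enum_val i, y, z)) => x y z; rewrite ffunE /=.
  by case: eqP => [->//|_]; rewrite !mul0r.
apply/ffunP => -[[x y] z]; rewrite sum_ffunE.
have [xA|xA] := boolP (x \in A); last first.
  by rewrite TA// big1// => i _; rewrite ffunE /= TA ?mulr0.
rewrite (bigD1 (enum_rank_in xA x))//= ffunE enum_rankK_in// eqxx mul1r.
rewrite big1 ?addr0// => i /negbTE ni; rewrite ffunE /=.
have [xi|] := eqVneq x (enum_val i); last by rewrite mul0r.
by move: ni; rewrite -(inj_eq enum_val_inj) enum_rankK_in// -xi eqxx.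
Qed.

Lemma y_rank_le (X Y Z : finType) (T : tensor F X Y Z) (A : {set Y}) :
  (forall x y z, y \notin A -> T (x, y, z) = 0) -> (y_rank T <= #|A|)%N.
Proof.
move=> TA; apply: (proj2 (leastP (ex_sum_of_y T))).
exists (fun i => [ffun v => (v.1.2 == enum_val i)%:R * T v]); split.
  move=> i; exists (fun y => (y == enum_val i)%:R).
  exists (fun x z => T (x, enum_val i, z)) => x y z; rewrite ffunE /=.
  by case: eqP => [->//|_]; rewrite !mul0r.
apply/ffunP => -[[x y] z]; rewrite sum_ffunE.
have [xA|xA] := boolP (y \in A); last first.
  by rewrite TA// big1// => i _; rewrite ffunE /= TA ?mulr0.
rewrite (bigD1 (enum_rank_in xA y))//= ffunE enum_rankK_in// eqxx mul1r.
rewrite big1 ?addr0// => i /negbTE ni; rewrite ffunE /=.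
have [xi|] := eqVneq y (enum_val i); last by rewrite mul0r.
by move: ni; rewrite -(inj_eq enum_val_inj) enum_rankK_in// -xi eqxx.
Qed.

Lemma z_rank_le (X Y Z : finType) (T : tensor F X Y Z) (A : {set Z}) :
  (forall x y z, z \notin A -> T (x, y, z) = 0) -> (z_rank T <= #|A|)%N.
Proof.
move=> TA; apply: (proj2 (leastP (ex_sum_of_z T))).
exists (fun i => [ffun v => (v.2 == enum_val i)%:R * T v]); split.
  move=> i; exists (fun z => (z == enum_val i)%:R).
  exists (fun x y => T (x, y, enum_val i)) => x y z; rewrite ffunE /=.
  by case: eqP => [->//|_]; rewrite !mul0r.
apply/ffunP => -[[x y] z]; rewrite sum_ffunE.
have [xA|xA] := boolP (z \in A); last first.
  by rewrite TA// big1// => i _; rewrite ffunE /= TA ?mulr0.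
rewrite (bigD1 (enum_rank_in xA z))//= ffunE enum_rankK_in// eqxx mul1r.
rewrite big1 ?addr0// => i /negbTE ni; rewrite ffunE /=.
have [xi|] := eqVneq z (enum_val i); last by rewrite mul0r.
by move: ni; rewrite -(inj_eq enum_val_inj) enum_rankK_in// -xi eqxx.
Qed.

(** Each term is assigned to the first of [A], [B], [C] containing its variable; each of the three
    parts is then sliced one variable at a time. *)
Lemma slice_rank_le_cover (X Y Z : finType) (T : tensor F X Y Z)
    (A : {set X}) (B : {set Y}) (C : {set Z}) :
  (forall x y z, T (x, y, z) != 0 -> [|| x \in A, y \in B | z \in C]) ->
  (slice_rank T <= #|A| + #|B| + #|C|)%N.
Proof.
move=> cov.
pose TX : {ffun X * Y * Z -> F} := [ffun v => if v.1.1 \in A then T v else 0].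
pose TY : {ffun X * Y * Z -> F} :=
  [ffun v => if (v.1.1 \notin A) && (v.1.2 \in B) then T v else 0].
pose TZ : {ffun X * Y * Z -> F} :=
  [ffun v => if (v.1.1 \notin A) && (v.1.2 \notin B) then T v else 0].
apply: (@leq_trans (x_rank TX + y_rank TY + z_rank TZ)).
  apply: (proj2 (leastP (ex_slice_rank T))).
  exists TX, TY, TZ; split=> //; apply/ffunP => -[[x y] z]; rewrite !ffunE /=.
  by case: (x \in A); case: (y \in B); rewrite /= ?addr0 ?add0r.
apply: leq_add; [apply: leq_add|].
- by apply: x_rank_le => x y z /negbTE xA; rewrite ffunE /= xA.
- by apply: y_rank_le => x y z /negbTE yB; rewrite ffunE /= yB andbF.
- apply: z_rank_le => x y z /negbTE zC; rewrite ffunE /=.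
  have := cov x y z; case: ifP => // /andP[/negbTE -> /negbTE ->].
  by rewrite zC /=; have [|_ /(_ isT)] := eqVneq (T (x, y, z)) 0.
Qed.

End SliceRankBounds.

(** * Blocks of tensor powers *)

Section Powers.
Variable F : fieldType.

Lemma digits_inj k n (u v : 'I_n -> nat) :
  (forall t, u t < k)%N -> (forall t, v t < k)%N ->
  (\sum_t u t * k ^ t = \sum_t v t * k ^ t)%N -> u =1 v.
Proof.
elim: n u v => [|n IHn] u v uk vk; first by move=> _ [].
rewrite !big_ord_recl /= !expn0 !muln1.
have E (w : 'I_n.+1 -> nat) : (\sum_(i < n) w (lift ord0 i) * k ^ bump 0 i =
    k * \sum_(i < n) w (lift ord0 i) * k ^ i)%N.
  by rewrite big_distrr; apply: eq_bigr => i _; rewrite /= /bump expnS mulnCA.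
rewrite !E => /digits2_inj[]// u0 uS t.
case: (unliftP ord0 t) => [i|] -> //.
by apply: (IHn (fun i => u (lift ord0 i)) (fun i => v (lift ord0 i))).
Qed.

Lemma card_family_prod (I J : finType) (P : I -> {pred J}) :
  #|family P| = (\prod_i #|P i|)%N.
Proof. by rewrite card_family foldrE big_map big_enum. Qed.

(** The factor [p i] is divisible by ['X^(e i)], so orders add and lowest coefficients multiply.
    This makes degenerations compatible with tensor products. *)
Lemma prod_low_coef (I : finType) (p : I -> {poly F}) (e : I -> nat) :
  (forall i d, (d < e i)%N -> (p i)`_d = 0) ->
  (\prod_i p i)`_(\sum_i e i) = \prod_i (p i)`_(e i) /\
  forall d, (d < \sum_i e i)%N -> (\prod_i p i)`_d = 0.
Proof.
move=> lo.
have pE i : p i = drop_poly (e i) (p i) * 'X^(e i).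
  rewrite -[LHS](poly_take_drop (e i)) [X in X + _](_ : _ = 0) ?add0r//.
  apply/polyP => d; rewrite coef_take_poly coef0; case: ifP => // /lo ->//.
have -> : \prod_i p i = (\prod_i drop_poly (e i) (p i)) * 'X^(\sum_i e i).
  by rewrite -prodrXr -big_split/=; apply: eq_bigr.
split=> [|d dl]; rewrite coefMXn; last by rewrite dl.
rewrite ltnn subnn -horner_coef0 horner_prod; apply: eq_bigr => i _.
by rewrite horner_coef0 coef_drop_poly.
Qed.

Lemma prod_bool (R : comNzRingType) (I : finType) (b : pred I) :
  \prod_i (b i)%:R = ([forall i, b i])%:R :> R.
Proof.
have [/forallP bT|/forallPn[i bi]] := boolP [forall i, b i].
  by rewrite big1// => i _; rewrite bT.
by rewrite (bigD1 i)//= (negbTE bi) mul0r.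
Qed.

Lemma sum_tensor_pow (X Y Z : finType) n (T : tensor F X Y Z)
    (f : 'I_n -> X -> {poly F}) (g : 'I_n -> Y -> {poly F})
    (h : 'I_n -> Z -> {poly F}) :
  \sum_u \sum_v \sum_w (tensor_pow T n (u, v, w))%:P *
    ((\prod_t f t (u t)) * (\prod_t g t (v t)) * (\prod_t h t (w t))) =
  \prod_t \sum_x \sum_y \sum_z (T (x, y, z))%:P * (f t x * g t y * h t z).
Proof.
rewrite bigA_distr_bigA/=; apply: eq_bigr => u _.
rewrite bigA_distr_bigA/=; apply: eq_bigr => v _.
rewrite bigA_distr_bigA/=; apply: eq_bigr => w _.
by rewrite ffunE /= rmorph_prod -!big_split.
Qed.

Lemma partition_index (X : finType) k (P : 'I_k -> {set X}) : is_partition P ->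
  exists ix : X -> 'I_k, forall x i, (x \in P i) = (ix x == i).
Proof.
move=> part; have [ix ixP] := choice part; exists ix => x i.
have [xi uniq] := ixP x; apply/idP/eqP => [/uniq//|<-//].
Qed.

Lemma block_nonzeroP (X Y Z : finType) k (T : tensor F X Y Z)
    (PX : 'I_k -> {set X}) (PY : 'I_k -> {set Y}) (PZ : 'I_k -> {set Z}) i j l :
  reflect (exists x y z, [/\ x \in PX i, y \in PY j, z \in PZ l &
    T (x, y, z) != 0]) (block_nonzero T PX PY PZ i j l).
Proof.
apply: (iffP idP) => [b0|[x [y [z [xi yj zl T0]]]]].
  have [|nv] := pselect (exists v, block T PX PY PZ i j l v != 0).
    case=> -[[x y] z]; rewrite ffunE /= => T0.
    by exists (val x), (val y), (val z); split=> //; apply: valP.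
  case/negP: b0; apply/eqP/ffunP => v; rewrite ffunE; apply/eqP/negPn/negP => v0.
  by apply: nv; exists v; rewrite ffunE; move: v0; rewrite [X in _ != X]ffunE.
apply/eqP => /ffunP/(_ (exist _ x xi, exist _ y yj, exist _ z zl)).
by rewrite !ffunE /= => /eqP; rewrite (negbTE T0).
Qed.

Lemma sum_sub (V : nmodType) (I : finType) (A : {set I}) (G : I -> V) :
  (forall x, x \notin A -> G x = 0) ->
  \sum_x G x = \sum_(x : {x | x \in A}) G (val x).
Proof.
move=> G0; rewrite (bigID (fun x => x \in A))/= [X in _ + X]big1 ?addr0//.
rewrite (reindex_omap (val : {x | x \in A} -> I) insub); last first.
  by move=> i iA; rewrite insubT.
by apply: eq_bigl => -[i iA] /=; rewrite insubT iA /= eqxx.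
Qed.

Lemma leq_sub_swap a b c d : (a + b <= c + d -> a - c <= d - b)%N.
Proof. lia. Qed.

Section Blocks.
Variables (X Y Z : finType) (k : nat) (T : tensor F X Y Z).
Variables (PX : 'I_k -> {set X}) (PY : 'I_k -> {set Y}) (PZ : 'I_k -> {set Z}).

Local Notation nz := (block_nonzero T PX PY PZ).

(** Extends a degeneration by zero to all variables and to natural-number indices. The types then no
    longer depend on the block or on [a], [b], [c], so degenerations of different blocks can be
    multiplied. *)
Lemma block_degenerates i j l (a b c : nat) :
  degenerates (block T PX PY PZ i j l) (mm_tensor F a b c) ->
  exists (f : X -> nat -> nat -> {poly F}) (g : Y -> nat -> nat -> {poly F})
         (h : Z -> nat -> nat -> {poly F}) (e : nat),
  [/\ forall x p q, x \notin PX i -> f x p q = 0,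
      forall y p q, y \notin PY j -> g y p q = 0,
      forall z p q, z \notin PZ l -> h z p q = 0
    & forall p q q' s s' p',
      let S := \sum_x \sum_y \sum_z (T (x, y, z))%:P *
         (f x p q * g y q' s * h z s' p') in
      S`_e = ([&& q == q', s == s', p' == p, p < a, q' < b & s' < c]%N)%:R /\
      forall d, (d < e)%N -> S`_d = 0].
Proof.
case=> [f0 [g0 [h0 [e deg]]]].
pose f x p q := match insub x : option {x | x \in PX i}, insub p : option 'I_a,
  insub q : option 'I_b with Some x, Some p, Some q => f0 x (p, q) | _, _, _ => 0 end.
pose g x p q := match insub x : option {x | x \in PY j}, insub p : option 'I_b,
  insub q : option 'I_c with Some x, Some p, Some q => g0 x (p, q) | _, _, _ => 0 end.
pose h x p q := match insub x : option {x | x \in PZ l}, insub p : option 'I_c,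
  insub q : option 'I_a with Some x, Some p, Some q => h0 x (p, q) | _, _, _ => 0 end.
have f1 x p q : ~~ [&& x \in PX i, p < a & q < b]%N -> f x p q = 0.
  by rewrite /f; do 3!case: insubP => [? -> _|//].
have g1 x p q : ~~ [&& x \in PY j, p < b & q < c]%N -> g x p q = 0.
  by rewrite /g; do 3!case: insubP => [? -> _|//].
have h1 x p q : ~~ [&& x \in PZ l, p < c & q < a]%N -> h x p q = 0.
  by rewrite /h; do 3!case: insubP => [? -> _|//].
exists f, g, h, e; split.
- by move=> x p q /negbTE xP; rewrite f1// xP.
- by move=> x p q /negbTE xP; rewrite g1// xP.
- by move=> x p q /negbTE xP; rewrite h1// xP.
move=> p q q' s s' p' S.
have [/and5P[pa qb qb' sc /andP[sc' pa']]|out] :=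
  boolP [&& p < a, q < b, q' < b, s < c, s' < c & p' < a]%N.
  pose x0 := (Ordinal pa, Ordinal qb); pose y0 := (Ordinal qb', Ordinal sc).
  pose z0 := (Ordinal sc', Ordinal pa').
  have -> : S = subst_coef (block T PX PY PZ i j l) f0 g0 h0 x0 y0 z0.
    rewrite /S /subst_coef (@sum_sub _ _ (PX i)) => [|x xP]; last first.
      rewrite big1// => y _; rewrite big1// => z _.
      by rewrite f1 ?(negbTE xP)// !mul0r mulr0.
    apply: eq_bigr => -[x xP] _.
    rewrite (@sum_sub _ _ (PY j)) => [|y yP]; last first.
      by rewrite big1// => z _; rewrite g1 ?(negbTE yP)// !(mul0r, mulr0).
    apply: eq_bigr => -[y yP] _.
    rewrite (@sum_sub _ _ (PZ l)) => [|z zP]; last first.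
      by rewrite h1 ?(negbTE zP)// !(mul0r, mulr0).
    apply: eq_bigr => -[z zP] _.
    by rewrite ffunE /= /f /g /h !insubT.
  have [-> lo] := deg x0 y0 z0; split=> //.
  by rewrite ffunE /= pa qb' sc' !andbT.
have S0 : S = 0.
  rewrite /S big1// => x _; rewrite big1// => y _; rewrite big1// => z _.
  have [fin|/f1 ->] := boolP [&& x \in PX i, p < a & q < b]%N; last first.
    by rewrite !(mul0r, mulr0).
  have [gin|/g1 ->] := boolP [&& y \in PY j, q' < b & s < c]%N; last first.
    by rewrite !(mul0r, mulr0).
  have [hin|/h1 ->] := boolP [&& z \in PZ l, s' < c & p' < a]%N; last first.
    by rewrite !(mul0r, mulr0).
  case/negP: out; move/and3P: fin => [_ -> ->].
  by move/and3P: gin => [_ -> ->]; move/and3P: hin => [_ -> ->].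
rewrite S0 coef0; split=> [|d _]; last by rewrite coef0.
case: (boolP [&& q == q', s == s', p' == p, p < a, q' < b & s' < c]%N) => //.
case/and5P=> /eqP qq /eqP ss /eqP pp pa /andP[qb sc].
by case/negP: out; rewrite pa qq qb ss sc pp pa.
Qed.

Lemma box_card n m (a : 'I_n -> nat) : (forall t, a t <= m)%N ->
  #|[set u : {ffun 'I_n -> 'I_m} | [forall t, u t < a t]%N]| = (\prod_t a t)%N.
Proof.
move=> am; transitivity #|family (fun t => [pred v : 'I_m | v < a t]%N)|.
  by apply: eq_card => u; rewrite inE; apply/forallP/familyP => u_t t;
     have := u_t t.
rewrite card_family_prod; apply: eq_bigr => t _.
have wI : injective (widen_ord (am t)).
  by move=> u v /(congr1 val) /= /ord_inj.
rewrite -[RHS](card_ord (a t)) -(card_imset _ wI).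
apply: eq_card => v; rewrite inE; apply/idP/imsetP => [va|[w _ ->]].
  by exists (Ordinal va) => //; apply/val_inj.
exact: (ltn_ord w).
Qed.

Lemma tight_weight : (exists ell : int, forall i j l, nz i j l ->
    (i.+1 + j.+1 + l.+1)%N%:Z = ell) ->
  exists l0, forall i j l, nz i j l -> (i + j + l)%N = l0.
Proof.
case=> ell ellP.
have [[i [j [l nz0]]]|none] := pselect (exists i j l, nz i j l).
  exists (i + j + l)%N => i' j' l' /ellP; rewrite -(ellP _ _ _ nz0) => -[]; lia.
by exists 0%N => i j l nz0; case: none; exists i, j, l.
Qed.

(** The costs are the codimensions of the graded pieces of an isotropic triple for the n-th power,
    so their total is at most its slice rank. On a nonzero block the graded pieces are isotropic,
    the block degenerates to a product of matrix multiplication tensors, and [mm_isotropic]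
    applies. *)
Lemma power_blocks n :
  is_partition PX -> is_partition PY -> is_partition PZ ->
  (forall i j l, nz i j l -> exists a b c : nat,
     [/\ degenerates (block T PX PY PZ i j l) (mm_tensor F a b c),
         (a * b)%N = #|PX i|, (b * c)%N = #|PY j| & (c * a)%N = #|PZ l|]) ->
  (exists l0, forall i j l, nz i j l -> (i + j + l)%N = l0) ->
  exists cX cY cZ : {ffun 'I_n -> 'I_k} -> nat,
  [/\ (\sum_I cX I + \sum_I cY I + \sum_I cZ I <= slice_rank (tensor_pow T n))%N,
      forall I, [/\ (cX I <= \prod_t #|PX (I t)|)%N,
        (cY I <= \prod_t #|PY (I t)|)%N & (cZ I <= \prod_t #|PZ (I t)|)%N]
    & forall I J L : {ffun 'I_n -> 'I_k}, (forall t, nz (I t) (J t) (L t)) ->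
       exists a b c : nat, [/\ (a * b = \prod_t #|PX (I t)|)%N,
         (b * c = \prod_t #|PY (J t)|)%N, (c * a = \prod_t #|PZ (L t)|)%N
       & (a * b * c <= c * cX I + a * cY J + b * cZ L)%N]].
Proof.
move=> /partition_index[iX iXP] /partition_index[iY iYP] /partition_index[iZ iZP].
move=> mm [l0 tight].
(* A block sequence is encoded by its base [k] digits: distinct sequences get distinct degrees,
   while tightness in each coordinate still makes the total degree constant. *)
pose lev (I : {ffun 'I_n -> 'I_k}) := (\sum_t I t * k ^ t)%N.
have levI : injective lev.
  move=> I J /digits_inj IJ; apply/ffunP => t; apply/val_inj.
  by apply: IJ => {}t; exact: ltn_ord.
pose blk (U : finType) (iU : U -> 'I_k) (u : {ffun 'I_n -> U}) := [ffun t => iU (u t)].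
pose d (U : finType) (iU : U -> 'I_k) u := lev (blk U iU u).
have lev_card (U : finType) (iU : U -> 'I_k) (P : 'I_k -> {set U}) I :
    (forall x i, (x \in P i) = (iU x == i)) ->
    #|level (d U iU) (lev I)| = (\prod_t #|P (I t)|)%N /\
    forall u, (u \in level (d U iU) (lev I)) = [forall t, u t \in P (I t)].
  move=> UP; have lP u : (u \in level (d U iU) (lev I)) = [forall t, u t \in P (I t)].
    rewrite inE (inj_eq levI); apply/eqP/forallP => [<- t|uP].
      by rewrite ffunE UP.
    by apply/ffunP => t; rewrite ffunE; apply/eqP; rewrite -UP.
  split=> //; rewrite -(card_family_prod (fun t => mem (P (I t)))).
  by apply: eq_card => u; rewrite lP; apply/forallP/familyP.
have [U [V [W [iso rk]]]] := slice_rank_isotropic (tensor_pow T n).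
pose cX I := codim (d X iX) U (lev I); pose cY I := codim (d Y iY) V (lev I).
pose cZ I := codim (d Z iZ) W (lev I).
exists cX, cY, cZ; split.
- apply: leq_trans rk; apply: leq_add; [apply: leq_add|].
  + by rewrite -[leqLHS](addnK (\rank U)) leq_sub2r// sum_codim_inj.
  + by rewrite -[leqLHS](addnK (\rank V)) leq_sub2r// sum_codim_inj.
  + by rewrite -[leqLHS](addnK (\rank W)) leq_sub2r// sum_codim_inj.
- by move=> I; split; rewrite -1?(proj1 (lev_card _ _ _ I iXP))
    -1?(proj1 (lev_card _ _ _ I iYP)) -1?(proj1 (lev_card _ _ _ I iZP)) leq_subr.
move=> I J L nzt.
have hom x y z : tensor_pow T n (x, y, z) != 0 ->
    (d X iX x + d Y iY y + d Z iZ z = \sum_(t < n) l0 * k ^ t)%N.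
  rewrite ffunE /= => /prodf_neq0 T0; rewrite /d /lev -!big_split/=.
  apply: eq_bigr => t _; rewrite -!mulnDl !ffunE; congr (_ * _)%N; apply: tight.
  apply/block_nonzeroP; exists (x t), (y t), (z t).
  by rewrite iXP iYP iZP !eqxx T0.
have lIJL : (lev I + lev J + lev L = \sum_(t < n) l0 * k ^ t)%N.
  rewrite /lev -!big_split; apply: eq_bigr => t _.
  by rewrite /= -!mulnDl (tight _ _ _ (nzt t)).
have giso := graded_isotropic hom lIJL iso.
have /choice[a /choice[b /choice[c /choice[f /choice[g /choice[h /choice[e deg]]]]]]] :
  forall t, exists a b c f g h e, [/\ (a * b)%N = #|PX (I t)|,
      (b * c)%N = #|PY (J t)|, (c * a)%N = #|PZ (L t)| &
   [/\ forall x p q, x \notin PX (I t) -> f x p q = 0 :> {poly F},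
      forall y p q, y \notin PY (J t) -> g y p q = 0 :> {poly F},
      forall z p q, z \notin PZ (L t) -> h z p q = 0 :> {poly F}
    & forall p q q' s s' p' : nat,
      let S := \sum_x \sum_y \sum_z (T (x, y, z))%:P *
         (f x p q * g y q' s * h z s' p') in
      S`_e = ([&& q == q', s == s', p' == p, p < a, q' < b & s' < c]%N)%:R /\
      forall d, (d < e)%N -> S`_d = 0]].
  move=> t; have [a [b [c [/block_degenerates[f [g [h [e degP]]]] ab bc ca]]]] :=
    mm _ _ _ (nzt t).
  by exists a, b, c, f, g, h, e.
(* A common bound lets the index ranges of all factors live in one finite type; [mm_on] then singles
   out the actual ranges. *)
have [m [am bm cm]] : exists m, [/\ forall t, (a t <= m)%N,
    forall t, (b t <= m)%N & forall t, (c t <= m)%N].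
  exists (\max_t a t + \max_t b t + \max_t c t)%N; split=> t.
  - by rewrite -addnA (leq_trans (leq_bigmax t))// leq_addr.
  - by rewrite addnAC (leq_trans (leq_bigmax t))// leq_addl.
  - by rewrite (leq_trans (leq_bigmax t))// leq_addl.
pose Jt : finType := {ffun 'I_n -> 'I_m}.
pose A := [set u : Jt | [forall t, u t < a t]%N].
pose B := [set u : Jt | [forall t, u t < b t]%N].
pose C := [set u : Jt | [forall t, u t < c t]%N].
have cA : #|A| = (\prod_t a t)%N by exact: box_card.
have cB : #|B| = (\prod_t b t)%N by exact: box_card.
have cC : #|C| = (\prod_t c t)%N by exact: box_card.
pose ff (x : {ffun 'I_n -> X}) (w : Jt * Jt) := \prod_t f t (x t) (w.1 t) (w.2 t).
pose gg (x : {ffun 'I_n -> Y}) (w : Jt * Jt) := \prod_t g t (x t) (w.1 t) (w.2 t).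
pose hh (x : {ffun 'I_n -> Z}) (w : Jt * Jt) := \prod_t h t (x t) (w.1 t) (w.2 t).
(* The substitutions multiply coordinatewise and the orders [e t] add up. *)
have degT x y z : (subst_coef (tensor_pow T n) ff gg hh x y z)`_(\sum_t e t) =
      mm_on F A B C (x, y, z) /\
    forall s, (s < \sum_t e t)%N ->
      (subst_coef (tensor_pow T n) ff gg hh x y z)`_s = 0.
  rewrite /subst_coef /ff /gg /hh.
  rewrite (sum_tensor_pow T (fun t u => f t u (x.1 t) (x.2 t))
    (fun t u => g t u (y.1 t) (y.2 t)) (fun t u => h t u (z.1 t) (z.2 t))).
  have [|-> lo] := @prod_low_coef _ (fun t => \sum_u \sum_v \sum_w
     (T (u, v, w))%:P * (f t u (x.1 t) (x.2 t) * g t v (y.1 t) (y.2 t) *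
        h t w (z.1 t) (z.2 t))) e.
    move=> t s se; have [_ _ _ [_ _ _ dt]] := deg t.
    by have [_ ->] := dt (x.1 t) (x.2 t) (y.1 t) (y.2 t) (z.1 t) (z.2 t).
  split=> //.
  under eq_bigr => t _.
    have [_ _ _ [_ _ _ dt]] := deg t.
    have [-> _] := dt (x.1 t) (x.2 t) (y.1 t) (y.2 t) (z.1 t) (z.2 t).
    over.
  rewrite prod_bool ffunE /= !inE; congr (nat_of_bool _)%:R.
  apply/forallP/idP => [H|]; last first.
    case/and5P=> /eqP-> /eqP-> /eqP-> /forallP aP /andP[/forallP bP /forallP cP] t.
    by rewrite !eqxx aP bP cP.
  have Ht t : [/\ x.2 t = y.1 t, y.2 t = z.1 t, z.2 t = x.1 t, x.1 t < a t &
      (y.1 t < b t) && (z.1 t < c t)]%N.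
    by have /and5P[/eqP/val_inj ? /eqP/val_inj ? /eqP/val_inj ? ? ?] := H t.
  apply/and5P; split.
  - by apply/eqP/ffunP => t; have [] := Ht t.
  - by apply/eqP/ffunP => t; have [] := Ht t.
  - by apply/eqP/ffunP => t; have [] := Ht t.
  - by apply/forallP => t; have [] := Ht t.
  - by apply/andP; split; apply/forallP => t; have [_ _ _ _ /andP[]] := Ht t.
have [cdX lX] := lev_card _ _ _ I iXP; have [cdY lY] := lev_card _ _ _ J iYP.
have [cdZ lZ] := lev_card _ _ _ L iZP.
have ff0 x w : x \notin level (d X iX) (lev I) -> ff x w = 0.
  rewrite lX => /forallPn[t xt]; have [_ _ _ [f0 _ _ _]] := deg t.
  by rewrite /ff (bigD1 t)//= f0// mul0r.
have gg0 x w : x \notin level (d Y iY) (lev J) -> gg x w = 0.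
  rewrite lY => /forallPn[t xt]; have [_ _ _ [_ g0 _ _]] := deg t.
  by rewrite /gg (bigD1 t)//= g0// mul0r.
have hh0 x w : x \notin level (d Z iZ) (lev L) -> hh x w = 0.
  rewrite lZ => /forallPn[t xt]; have [_ _ _ [_ _ h0 _]] := deg t.
  by rewrite /hh (bigD1 t)//= h0// mul0r.
have [U' [V' [W' [iso' rU rV rW]]]] := degenerate_isotropic degT ff0 gg0 hh0
  (graded_sub _ _ _) (graded_sub _ _ _) (graded_sub _ _ _) giso.
exists (\prod_t a t)%N, (\prod_t b t)%N, (\prod_t c t)%N; split.
- by rewrite -big_split; apply: eq_bigr => t _; have [] := deg t.
- by rewrite -big_split; apply: eq_bigr => t _; have [] := deg t.
- by rewrite -big_split; apply: eq_bigr => t _; have [] := deg t.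
rewrite -cA -cB -cC; apply: leq_trans (mm_isotropic iso') _.
apply: leq_add; [apply: leq_add|]; rewrite leq_mul2l; apply/orP; right.
- exact: leq_sub_swap rU.
- exact: leq_sub_swap rV.
- exact: leq_sub_swap rW.
Qed.

End Blocks.

End Powers.

(** * Entropy estimates *)

Section Entropy.
Variable R : realType.

Lemma ln_le_subr1 (x : R) : 0 < x -> ln x <= x - 1.
Proof. by move=> x0; have := @le_ln1Dx R (x - 1); rewrite [1 + _]addrC subrK; apply; lra. Qed.

Section Weighted.
Variables (k : nat) (N : 'I_k -> R).

Definition weighted_entropy (m : 'I_k -> R) : R := \sum_i m i * ln (N i / m i).

(** The inequality ln x <= x - 1 is applied to [Q i / P i], term by term. *)
Lemma gibbs (P Q : 'I_k -> R) :
  (forall i, 0 <= P i) -> (forall i, 0 <= N i) ->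
  (forall i, 0 < P i -> 0 < N i /\ 0 < Q i) -> (forall i, 0 <= Q i) ->
  \sum_i Q i <= \sum_i P i ->
  weighted_entropy P <= \sum_i P i * ln (N i / Q i).
Proof.
move=> P0 N0 Ppos Q0 QP; rewrite -subr_ge0 -sumrB.
apply: le_trans (_ : \sum_i (P i - Q i) <= _); first by rewrite sumrB subr_ge0.
apply: ler_sum => i _; have [Pi|Pi] := eqVneq (P i) 0.
  by rewrite Pi !mul0r subr0 sub0r oppr_le0.
have Pp : 0 < P i by rewrite lt_neqAle eq_sym Pi P0.
have [Np Qp] := Ppos i Pp.
rewrite -mulrBr !ln_div ?posrE//.
have lnQP : P i * (ln (Q i) - ln (P i)) <= Q i - P i.
  apply: le_trans (_ : P i * (Q i / P i - 1) <= _); last first.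
    by rewrite mulrBr mulr1 mulrCA divff ?mulr1.
  by rewrite ler_pM2l// -ln_div ?posrE// ln_le_subr1// divr_gt0.
rewrite (_ : _ * _ = - (P i * (ln (Q i) - ln (P i)))); last by ring.
lra.
Qed.

(** A near-maximizer, obtained from boundedness alone, takes the place of a compactness argument. *)
Lemma near_max (A : Type) (S : A -> Prop) (f : A -> R) (L d : R) :
  (exists a, S a) -> (forall a, S a -> f a <= L) -> 0 < d ->
  exists2 a, S a & forall b, S b -> f b <= f a + d.
Proof.
move=> [a0 Sa0] fL d0; pose E := [set f a | a in [set a | S a]]%classic.
have supE : has_sup E.
  by split; [exists (f a0), a0 | exists L => _ [a Sa <-]; exact: fL].
have [_ [a Sa <-] fa] := sup_adherent d0 supE; exists a => // b Sb.
have : f b <= sup E by apply: ub_le_sup; [case: supE | exists b].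
lra.
Qed.

(* Approximate first-order optimality condition for the weighted entropy on the
   convex set [D].  Mixing with the interior point [u] keeps the optimum away
   from the boundary, where the derivative of the entropy is infinite. *)
Lemma entropy_dual (D : ('I_k -> R) -> Prop) (u : 'I_k -> R) (kap L c : R) :
  (forall i, N i = 0 \/ 1 <= N i) ->
  (forall m, D m -> [/\ forall i, 0 <= m i, \sum_i m i = 1 &
     forall i, N i = 0 -> m i = 0]) ->
  (forall a b s, D a -> D b -> 0 <= s <= 1 ->
     D (fun i => (1 - s) * a i + s * b i)) ->
  D u -> 0 < kap -> (forall i, 1 <= N i -> kap <= u i) ->
  (forall m, D m -> weighted_entropy m <= L) -> L < c ->
  exists v : 'I_k -> R, \sum_i N i * expR (- v i) <= 1 /\
    forall q, D q -> \sum_i q i * v i <= c.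
Proof.
move=> N01 Dprob Dconv Du kap0 ukap DL Lc.
have N0 i : 0 <= N i by case: (N01 i) => [->|] //; lra.
have le1 m i : D m -> m i <= 1.
  move=> /Dprob[m0 m1 _]; rewrite -m1 (bigD1 i)//= lerDl sumr_ge0// => j _.
have lnge0 m i : D m -> 1 <= N i -> 0 < m i -> 0 <= ln (N i / m i).
  move=> Dm Ni mi; apply: ln_ge0; rewrite ler_pdivlMr// mul1r.
  by apply: le_trans Ni; apply: le1.
have went0 m : D m -> 0 <= weighted_entropy m.
  move=> Dm; apply: sumr_ge0 => i _; have [m0 _ mN] := Dprob _ Dm.
  have [->|mi] := eqVneq (m i) 0; first by rewrite mul0r.
  apply: mulr_ge0 => //; case: (N01 i) => [/mN/eqP|Ni]; first by rewrite (negbTE mi).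
  by apply: lnge0; rewrite // lt_neqAle eq_sym mi m0.
have L0 : 0 <= L by apply: le_trans (DL u Du); apply: went0.
(* Chosen so that [(1 - eps) * c = L + eta]: half the gap between [L] and [c] pays for mixing with
   [u], the other half for the approximation errors. *)
pose eps := (c - L) / (2 * c); pose eta := (c - L) / 2.
have c0 : 0 < c by lra.
have eta0 : 0 < eta by rewrite /eta; lra.
have eps01 : 0 < eps < 1.
  apply/andP; split; first by apply: divr_gt0; lra.
  by rewrite /eps ltr_pdivrMr; lra.
have epsc : (1 - eps) * c = L + eta.
  by rewrite /eps /eta; field; lra.
case/andP: eps01 => eps0 eps1.
pose mix (a : 'I_k -> R) i := (1 - eps) * a i + eps * u i.
have Dmix a : D a -> D (mix a) by move=> Da; apply: Dconv => //; lra.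
pose ka := eps * kap; have ka0 : 0 < ka by apply: mulr_gt0.
have mixk a i : D a -> 1 <= N i -> ka <= mix a i.
  move=> Da Ni; have [a0 _ _] := Dprob _ Da; rewrite /mix.
  have := mulr_ge0 (_ : 0 <= 1 - eps) (a0 i); rewrite subr_ge0 => /(_ (ltW eps1)).
  have : ka <= eps * u i by rewrite ler_pM2l// ukap.
  lra.
(* The step length: at most 1 for convexity, and so small that moving by [s] raises a coordinate of
   at least [ka] by a factor of at most [1 + eta / 2]. *)
pose s := Num.min 1 (ka * eta / 2).
have s0 : 0 < s by rewrite /s lt_min ltr01 /= divr_gt0// mulr_gt0.
have s1 : s <= 1 by rewrite /s ge_min lexx.
have ska : s / ka <= eta / 2.
  rewrite ler_pdivrMr//; apply: le_trans (_ : ka * eta / 2 <= _).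
    by rewrite /s ge_min lexx orbT.
  by lra.
have d0 : 0 < s * eta / 2 by rewrite divr_gt0// mulr_gt0.
have [a Da amax] := near_max (ex_intro _ u Du)
  (fun a Da => DL _ (Dmix a Da)) d0.
pose P := mix a; have DP : D P := Dmix _ Da.
have [P0 P1 PN] := Dprob _ DP.
(* With these weights [N i * expR (- v i)] is [P i] wherever [N i] is nonzero. *)
exists (fun i => ln (N i / P i)); split.
  rewrite -P1; apply: ler_sum => i _; case: (N01 i) => [Ni|Ni].
    by rewrite Ni mul0r P0.
  have Pi : 0 < P i by apply: lt_le_trans ka0 _; apply: mixk.
  rewrite -lnV ?posrE ?divr_gt0//; last by lra.
  rewrite lnK ?posrE ?invr_gt0 ?divr_gt0//; try lra.
  by rewrite invf_div mulrCA divff ?mulr1//; apply: lt0r_neq0; lra.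
move=> q Dq; pose Q := mix q; have DQ : D Q := Dmix _ Dq.
have [Q0 Q1 QN] := Dprob _ DQ.
(* The first-order condition is tested with a finite step from [P] towards [Q]. *)
pose Ps i := (1 - s) * P i + s * Q i.
have PsE : Ps = mix (fun i => (1 - s) * a i + s * q i).
  by apply/funext => i; rewrite /Ps /P /Q /mix; ring.
have Dsq : D (fun i => (1 - s) * a i + s * q i) by apply: Dconv => //; lra.
have DPs : D Ps by rewrite PsE; apply: Dmix.
have [Ps0 Ps1 PsN] := Dprob _ DPs.
have Pspos i : 1 <= N i -> 0 < Ps i.
  by move=> Ni; rewrite PsE; apply: lt_le_trans ka0 _; apply: mixk.
have maxPs : weighted_entropy Ps <= weighted_entropy P + s * eta / 2.
  by rewrite PsE; apply: amax.
have gib : weighted_entropy P <= \sum_i P i * ln (N i / Ps i).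
  apply: gibbs => // [i Pi|]; last by rewrite P1 Ps1.
  case: (N01 i) => [/PN Pi0|Ni]; first by rewrite Pi0 ltxx in Pi.
  by split; [lra | exact: Pspos].
have PsS : weighted_entropy Ps = (1 - s) * (\sum_i P i * ln (N i / Ps i)) +
    s * (\sum_i Q i * ln (N i / Ps i)).
  rewrite !mulr_sumr -big_split /=; apply: eq_bigr => i _.
  by rewrite {1}/Ps mulrDl !mulrA.
(* Gibbs bounds the [P] part from below by the entropy of [P], and near-maximality bounds the
   entropy of [Ps] from above. Subtracting and dividing by [s] turns the tolerance [s * eta / 2]
   into [eta / 2]. *)
have QPs : \sum_i Q i * ln (N i / Ps i) <= L + eta / 2.
  have g1 : (1 - s) * weighted_entropy P <=
      (1 - s) * (\sum_i P i * ln (N i / Ps i)) by rewrite ler_wpM2l//; lra.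
  have g2 : s * (\sum_i Q i * ln (N i / Ps i)) <= s * (weighted_entropy P + eta / 2).
    by rewrite mulrDr mulrA; lra.
  by move: g2; rewrite ler_pM2l// => g2; have := DL _ DP; lra.
(* Replacing [Ps] by [P] inside the logarithm costs at most [eta / 2]. *)
have QP : \sum_i Q i * ln (N i / P i) <= L + eta.
  suff : \sum_i Q i * ln (N i / P i) <= \sum_i (Q i * ln (N i / Ps i) + Q i * (eta / 2)).
    by rewrite big_split/= -mulr_suml Q1; lra.
  apply: ler_sum => i _; rewrite -mulrDr; case: (N01 i) => [/QN->|Ni].
    by rewrite !mul0r.
  apply: ler_wpM2l => //; have Pi := mixk _ i Da Ni; rewrite -/(P i) in Pi.
  have Pp : 0 < P i by apply: lt_le_trans ka0 Pi.
  have Psp := Pspos i Ni; rewrite !ln_div ?posrE//; try lra.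
  have PsP : Ps i / P i <= 1 + eta / 2.
    rewrite ler_pdivrMr// mulrDl mul1r /Ps.
    have : s * Q i <= eta / 2 * P i.
      apply: le_trans (_ : s <= _); first by rewrite ger_pMr// le1.
      have : s / ka * ka <= eta / 2 * P i.
        apply: ler_pM => //; first by rewrite divr_ge0 ?ltW.
        exact: ltW.
      by rewrite divfK ?gt_eqF.
    have : 0 <= s * P i by rewrite mulr_ge0 ?ltW.
    by rewrite mulrBl mul1r; lra.
  have := ln_le_subr1 (divr_gt0 Psp Pp); rewrite ln_div ?posrE//; lra.
(* The share of [u] in [Q] contributes nonnegatively and is dropped; where [N i = 0] the logarithm
   is [ln 0], which is 0 by convention. *)
have qv : (1 - eps) * (\sum_i q i * ln (N i / P i)) <= \sum_i Q i * ln (N i / P i).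
  rewrite mulr_sumr; apply: ler_sum => i _; rewrite /Q /mix [leRHS]mulrDl mulrA lerDl.
  have [u0 _ uN] := Dprob _ Du.
  apply: mulr_ge0; first by rewrite mulr_ge0// ltW.
  case: (N01 i) => [->|Ni].
    by rewrite mul0r ln0.
  by apply: lnge0 => //; apply: lt_le_trans ka0 _; apply: mixk.
have : (1 - eps) * (\sum_i q i * ln (N i / P i)) <= (1 - eps) * c by lra.
by rewrite ler_pM2l; lra.
Qed.

End Weighted.

(** For t >= -1/4, exp(-t) <= 1 - t + 2 t^2, because (1 - t + 2 t^2)(1 + t) = 1 + t^2 (1 + 2 t) >=
    1. With mean d and |y i| <= Y, the choice s = d / (4 Y^2) makes the quadratic loss half of the
    linear gain s d. *)
Lemma exp_moment_lt1 (k : nat) (m y : 'I_k -> R) :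
  (forall i, 0 <= m i) -> \sum_i m i = 1 -> 0 < \sum_i m i * y i ->
  exists2 s, 0 < s & \sum_i m i * expR (- (s * y i)) < 1.
Proof.
move=> m0 m1 d0; set d := \sum_i _ in d0.
pose Y := \sum_i `|y i| + 1.
have yY i : `|y i| <= Y.
  rewrite /Y (bigD1 i)//=; have : 0 <= \sum_(j | j != i) `|y j| by apply: sumr_ge0.
  lra.
have Y1 : 1 <= Y by rewrite /Y lerDr sumr_ge0.
have dY : d <= Y.
  rewrite -[Y]mul1r -m1 mulr_suml; apply: ler_sum => i _; rewrite ler_wpM2l//.
  by apply: le_trans (ler_norm _) (yY i).
have Y20 : 0 < 4 * Y ^+ 2 by rewrite mulr_gt0// exprn_gt0//; lra.
pose s := d / (4 * Y ^+ 2); have s0 : 0 < s by apply: divr_gt0.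
have sY2 : s * (4 * Y ^+ 2) = d by rewrite /s divfK ?gt_eqF.
have sY : s * Y <= 1 / 4.
  rewrite -(@ler_pM2r _ (4 * Y)); last by lra.
  rewrite (_ : s * Y * (4 * Y) = d); first by lra.
  by rewrite -sY2; ring.
exists s => //.
have bnd i : expR (- (s * y i)) <= 1 - s * y i + 2 * s ^+ 2 * Y ^+ 2.
  pose t := s * y i; have tY : `|t| <= s * Y.
    by rewrite normrM gtr0_norm// ler_pM2l.
  have t4 : -(1/4) <= t by have := lerNnormlW tY; lra.
  have t2 : t ^+ 2 <= s ^+ 2 * Y ^+ 2.
    rewrite -exprMn -(real_normK (num_real t)) lerXn2r ?nnegrE//.
    by rewrite mulr_ge0 ?ltW//; lra.
  rewrite -/t expRN; apply: le_trans (_ : 1 - t + 2 * t ^+ 2 <= _); last by nra.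
  have e1 := expR_ge1Dx t; rewrite -[leLHS]mul1r ler_pdivrMr ?expR_gt0//.
  have q0 : 0 <= 1 - t + 2 * t ^+ 2 by nra.
  apply: le_trans (_ : (1 - t + 2 * t ^+ 2) * (1 + t) <= _); last first.
    by rewrite ler_wpM2l.
  have : 0 <= t ^+ 2 * (1 + 2 * t) by rewrite mulr_ge0 ?sqr_ge0//; lra.
  nra.
apply: le_lt_trans (_ : 1 - s * d + 2 * s ^+ 2 * Y ^+ 2 < _); last first.
  rewrite (_ : 2 * s ^+ 2 * Y ^+ 2 = s * d / 2); last by rewrite -sY2; field.
  have : 0 < s * d by apply: mulr_gt0.
  lra.
apply: le_trans (_ : \sum_i m i * (1 - s * y i + 2 * s ^+ 2 * Y ^+ 2) <= _).
  by apply: ler_sum => i _; rewrite ler_wpM2l.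
under eq_bigr => i _ do rewrite mulrDr mulrBr mulr1 mulrCA.
by rewrite big_split/= sumrB m1 -mulr_sumr -mulr_suml m1 mul1r.
Qed.

(* Chernoff bound: a sequence [I] whose product weight is at least [expR c ^+ n]
   is charged to its cost, the others to the exponential moment. *)
Lemma chernoff_cost (k n : nat) (m y : 'I_k -> R) (N : 'I_k -> nat) (c s : R)
    (C : {ffun 'I_n -> 'I_k} -> nat) :
  (forall i, 0 <= m i) -> 0 < s ->
  (forall i, 0 < m i -> m i * expR (y i) * expR c = (N i)%:R) ->
  (forall I, C I <= \prod_t N (I t))%N ->
  \sum_(I : {ffun 'I_n -> 'I_k}) (\prod_t m (I t)) * ((C I)%:R / (\prod_t N (I t))%:R) <=
    (\sum_I C I)%:R / expR c ^+ n + (\sum_i m i * expR (- (s * y i))) ^+ n.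
Proof.
move=> m0 s0 mN CN.
have -> : (\sum_i m i * expR (- (s * y i))) ^+ n =
   \sum_(I : {ffun 'I_n -> 'I_k}) \prod_t (m (I t) * expR (- (s * y (I t)))).
  by rewrite -(bigA_distr_bigA (fun _ i => m i * expR (- (s * y i))))/= prodr_const card_ord.
rewrite natr_sum mulr_suml -big_split/=; apply: ler_sum => I _.
have prod0 : 0 <= \prod_t (m (I t) * expR (- (s * y (I t)))).
  by apply: prodr_ge0 => t _; rewrite mulr_ge0 ?expR_ge0.
have cost0 : 0 <= (C I)%:R / expR c ^+ n by rewrite divr_ge0 ?exprn_ge0 ?expR_ge0.
have [/eqP/prodf_eq0[t _ /eqP mt]|/prodf_neq0 mI] := eqVneq (\prod_t m (I t)) 0.
  by rewrite (bigD1 t)//= mt !mul0r addr_ge0.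
have mp t : 0 < m (I t) by rewrite lt_neqAle eq_sym mI// m0.
have Mp : 0 < \prod_t m (I t) by apply: prodr_gt0.
have NE : (\prod_t N (I t))%:R =
    (\prod_t m (I t)) * expR (\sum_t y (I t)) * expR c ^+ n.
  rewrite natr_prod expR_sum -[n in _ ^+ n]card_ord -prodr_const -!big_split/=.
  by apply: eq_bigr => t _; rewrite mN.
have Np : 0 < (\prod_t N (I t))%:R :> R.
  by rewrite NE !mulr_gt0 ?exprn_gt0 ?expR_gt0.
have [Y0|Y0] := leP 0 (\sum_t y (I t)).
  apply: le_trans (_ : (C I)%:R / expR c ^+ n <= _); last by rewrite lerDl.
  rewrite NE mulrCA ler_wpM2l// !invfM !mulrA divff ?gt_eqF// mul1r.
  rewrite ger_pMl ?invr_gt0 ?exprn_gt0 ?expR_gt0//.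
  by rewrite invf_le1 ?expR_gt0// -[leLHS]expR0 ler_expR.
apply: le_trans (_ : \prod_t (m (I t) * expR (- (s * y (I t)))) <= _); last first.
  by rewrite lerDr.
rewrite big_split/= ler_wpM2l ?(ltW Mp)//.
apply: le_trans (_ : 1 <= _); first by rewrite ler_pdivrMr// mul1r ler_nat CN.
rewrite -expR_sum -[leLHS]expR0 ler_expR sumrN -mulr_sumr oppr_ge0 pmulr_rle0//.
exact: ltW.
Qed.

Lemma sum_product_pushforward (S : finType) (k n : nat) (pi : S -> 'I_k)
    (p : S -> R) (h : {ffun 'I_n -> 'I_k} -> R) :
  \sum_(tau : {ffun 'I_n -> S}) (\prod_t p (tau t)) * h [ffun t => pi (tau t)] =
  \sum_(I : {ffun 'I_n -> 'I_k}) (\prod_t \sum_(s | pi s == I t) p s) * h I.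
Proof.
rewrite (partition_big (fun tau : {ffun 'I_n -> S} => [ffun t => pi (tau t)]) xpredT)//=.
apply: eq_bigr => I _; rewrite bigA_distr_big_dep mulr_suml.
apply: eq_big => [tau|tau /eqP->//].
apply/eqP/familyP => [<- t|tauI]; first by rewrite ffunE; apply: eqxx.
by apply/ffunP => t; rewrite ffunE; apply/eqP; exact: (tauI t).
Qed.

(** The constants 3 and 1/2 disappear under the n-th root: on logarithms they contribute O(1/n). *)
Lemma root_limit (S : nat -> nat) (L : R) :
  (forall c, L < c -> forall n, (S n)%:R <= 3 * expR c ^+ n) ->
  (forall c, c < L -> exists M, forall n, (M <= n)%N ->
     expR c ^+ n / 2 <= (S n)%:R) ->
  (powR (S n)%:R n%:R^-1 @[n --> \oo] --> expR L)%classic.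
Proof.
move=> up low.
have [M1 low1] := low (L - 1) ltac:(lra).
have S0 n : (M1 <= n)%N -> 0 < (S n)%:R :> R.
  by move/low1; apply: lt_le_trans; rewrite divr_gt0 ?exprn_gt0 ?expR_gt0.
have lim : (ln (S n)%:R / n%:R @[n --> \oo] --> L)%classic.
  apply/cvgrPdist_le => e e0.
  have e2 : 0 < e / 2 by rewrite divr_gt0.
  have [M lowM] := low (L - e / 2) ltac:(lra).
  near=> n.
  have n0 : 0 < n%:R :> R by rewrite ltr0n; near: n; exact: nbhs_infty_gt.
  have Sp : 0 < (S n)%:R :> R by apply: S0; near: n; exact: nbhs_infty_ge.
  have ln3 : ln 3 <= e / 2 * n%:R.
    rewrite mulrC -ler_pdivrMr//; near: n; exact: nbhs_infty_ger.
  have ln23 : ln 2 <= ln 3 :> R by rewrite ler_ln ?posrE//; lra.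
  have e0n x : 0 < expR x ^+ n :> R by rewrite exprn_gt0 ?expR_gt0.
  have upn : ln (S n)%:R <= ln 3 + (L + e / 2) * n%:R.
    apply: le_trans (_ : ln (3 * expR (L + e / 2) ^+ n) <= _).
      by rewrite ler_ln ?posrE ?mulr_gt0// up//; lra.
    by rewrite lnM ?posrE// lnXn ?expR_gt0// expRK mulr_natr.
  have lown : (L - e / 2) * n%:R - ln 2 <= ln (S n)%:R.
    apply: le_trans (_ : ln (expR (L - e / 2) ^+ n / 2) <= _).
      by rewrite ln_div ?posrE// lnXn ?expR_gt0// expRK mulr_natr.
    rewrite ler_ln ?posrE ?divr_gt0// lowM//; near: n; exact: nbhs_infty_ge.
  rewrite ler_norml; apply/andP; split.
    rewrite lerBrDr -lerBrDl opprK ler_pdivrMr// (le_trans upn)//; lra.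
  rewrite lerBlDr -lerBlDl ler_pdivlMr// (le_trans _ lown)//; lra.
have : (expR (ln (S n)%:R / n%:R) @[n --> \oo] --> expR L)%classic.
  by apply: (cvg_comp _ (@expR R) lim); exact: continuous_expR.
apply: cvg_trans; apply: near_eq_cvg; near=> n.
have Sp : 0 < (S n)%:R :> R by apply: S0; near: n; exact: nbhs_infty_ge.
by rewrite /powR gt_eqF// mulrC.
Unshelve. all: by end_near.
Qed.

End Entropy.

(** * Symmetric distributions and the lower bound *)

Section SymmetricDistributions.
Variables (R : realType) (F : fieldType) (X Y Z : finType) (k : nat).
Variable T : tensor F X Y Z.
Variables (PX : 'I_k -> {set X}) (PY : 'I_k -> {set Y}) (PZ : 'I_k -> {set Z}).

Local Notation idx := ('I_k * 'I_k * 'I_k)%type.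
Local Notation nz := (block_nonzero T PX PY PZ).
Local Notation sym := (sym_distr T PX PY PZ (R := R)).
Local Notation size := (fun i => #|PX i|%:R : R).

Definition rot_idx (s : idx) : idx := (s.1.2, s.2, s.1.1).

Lemma rot_idx_inj : injective rot_idx.
Proof. by move=> [[i j] l] [[i' j'] l'] [-> -> ->]. Qed.

Definition marginal (p : idx -> R) (i : 'I_k) : R := \sum_(s | s.1.1 == i) p s.

Lemma marginal_expectation (S : finType) (pi : S -> 'I_k) (p : S -> R)
    (v : 'I_k -> R) :
  \sum_i (\sum_(s | pi s == i) p s) * v i = \sum_s p s * v (pi s).
Proof.
rewrite [RHS](partition_big pi xpredT)//=; apply: eq_bigr => i _.
by rewrite mulr_suml; apply: eq_bigr => s /eqP ->.
Qed.

(** Cyclic invariance makes the three marginals equal, so one Chernoff bound serves all three sets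
    of variables. *)
Lemma marginal_rot (p : idx -> R) i :
  (forall i j l, p (i, j, l) = p (j, l, i)) ->
  \sum_(s | s.1.2 == i) p s = marginal p i /\
  \sum_(s | s.2 == i) p s = marginal p i.
Proof.
move=> sp; have prot s : p (rot_idx s) = p s by case: s => [[a b] c]; rewrite sp.
have E : \sum_(s | s.1.2 == i) p s = marginal p i.
  rewrite /marginal [RHS](reindex_inj rot_idx_inj)/=.
  by apply: eq_bigr => s _; rewrite prot.
split=> //; rewrite -E [RHS](reindex_inj rot_idx_inj)/=.
by apply: eq_bigr => s _; rewrite prot.
Qed.

Lemma marginalXE p i : sym p -> marginalX T PX PY PZ p i = marginal p i.
Proof.
move=> [_ _ p0 _].
transitivity (\sum_a \sum_b \sum_c if a == i then p (a, b, c) else 0).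
  rewrite (bigD1 i)//= [X in _ + X]big1 ?addr0 => [|a /negbTE ai]; last first.
    by rewrite big1// => b _; rewrite big1// => c _; rewrite ai.
  apply: eq_bigr => j _; rewrite big_mkcond; apply: eq_bigr => l _.
  by rewrite eqxx; case: ifPn => // /p0.
rewrite pair_bigA/= pair_bigA/= /marginal [RHS]big_mkcond.
by apply: eq_bigr => -[[a b] c].
Qed.

Lemma marginal_ge0 p i : sym p -> 0 <= marginal p i.
Proof. by case=> p0 *; apply: sumr_ge0. Qed.

Lemma marginal_sum p : sym p -> \sum_i marginal p i = 1.
Proof.
case=> _ <- _ _; have := marginal_expectation (fun s : idx => s.1.1) p (fun=> 1).
under eq_bigr => i _ do rewrite mulr1.
by under [X in _ = X -> _]eq_bigr => i _ do rewrite mulr1.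
Qed.

Lemma marginal_support p i : sym p -> marginal p i != 0 -> (0 < #|PX i|)%N.
Proof.
case=> [p0 _ pnz _]; apply: contraNltn; rewrite leqn0 cards_eq0 => /eqP Pi.
rewrite /marginal big1// => -[[a j] l] /= /eqP ->; apply: pnz.
by apply/block_nonzeroP => -[x [y [z [xi]]]]; rewrite Pi inE in xi.
Qed.

Lemma p_X_entropy p : sym p ->
  p_X T PX PY PZ p = expR (weighted_entropy size (marginal p)).
Proof.
move=> sp; rewrite /p_X expR_sum; apply: eq_bigr => i _.
rewrite marginalXE//; have [->|mi] := eqVneq (marginal p i) 0.
  by rewrite powRr0 mul0r expR0.
rewrite /powR gt_eqF// divr_gt0//; first by rewrite ltr0n (marginal_support sp).
by rewrite lt_neqAle eq_sym mi marginal_ge0.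
Qed.

(** Under p^n, every triple of block sequences of positive mass has relative codimensions adding up
    to at least 1. Averaging and applying [chernoff_cost] to each of the three sequences bounds 1 by
    the slice rank over [expR c ^+ n] plus an exponentially small error. *)
Lemma slice_rank_pow_lower p c :
  is_partition PX -> is_partition PY -> is_partition PZ ->
  laser_ready T PX PY PZ -> sym p ->
  c < weighted_entropy size (marginal p) ->
  exists M, forall n, (M <= n)%N ->
    expR c ^+ n / 2 <= (slice_rank (tensor_pow T n))%:R.
Proof.
move=> partX partY partZ [mm /tight_weight tight _ [cards _]] sp cPhi.
(* [y] is the excess of the logarithmic weight over [c]; its mean under [m] is positive by the
   assumption on [c]. *)
pose m := marginal p; pose y i := ln (#|PX i|%:R / m i) - c.
have m0 i : 0 <= m i by apply: marginal_ge0.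
have m1 : \sum_i m i = 1 by apply: marginal_sum.
have my : 0 < \sum_i m i * y i.
  under eq_bigr => i _ do rewrite mulrBr.
  by rewrite sumrB -mulr_suml m1 mul1r subr_gt0.
have [s s0 rho1] := exp_moment_lt1 m0 m1 my.
set rho := \sum_i _ in rho1.
have rho0 : 0 <= rho by apply: sumr_ge0 => i _; rewrite mulr_ge0 ?expR_ge0.
(* The bound 1/6 makes the three error terms together at most 1/2. *)
have [M _ rhoM] : (\forall n \near \oo, rho ^+ n <= 1 / 6)%classic.
  have : `|rho| < 1 by rewrite ger0_norm.
  move=> /cvg_expr/cvgrPdist_le/(_ (1 / 6)) [|M _ HM]; first by lra.
  exists M => // n /HM; rewrite /= sub0r normrN ger0_norm// exprn_ge0//.
exists M => n /rhoM rhon.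
have [cX [cY [cZ [csum cle cblk]]]] := power_blocks n partX partY partZ mm tight.
set S := slice_rank _ in csum *.
have mN i : 0 < m i -> m i * expR (y i) * expR c = #|PX i|%:R.
  move=> mi; have Ni : (0 < #|PX i|)%N by rewrite (marginal_support sp)// gt_eqF.
  rewrite -mulrA -expRD subrK lnK ?posrE ?divr_gt0 ?ltr0n//.
  by rewrite mulrCA divff ?mulr1// gt_eqF.
pose h (C : {ffun 'I_n -> 'I_k} -> nat) I : R := (C I)%:R / (\prod_t #|PX (I t)|)%:R.
have chern (C : {ffun 'I_n -> 'I_k} -> nat) :
    (forall I : {ffun 'I_n -> 'I_k}, C I <= \prod_t #|PX (I t)|)%N ->
    \sum_(I : {ffun 'I_n -> 'I_k}) (\prod_t m (I t)) * h C I <=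
      (\sum_I C I)%:R / expR c ^+ n + rho ^+ n.
  by move=> CN; exact: (chernoff_cost m0 s0 mN CN).
have cardsY i : #|PY i| = #|PX i| by have [] := cards i.
have cardsZ i : #|PZ i| = #|PX i| by have [-> ->] := cards i.
have prodY (I : {ffun 'I_n -> 'I_k}) : (\prod_t #|PY (I t)| = \prod_t #|PX (I t)|)%N.
  by apply: eq_bigr => t _.
have prodZ (I : {ffun 'I_n -> 'I_k}) : (\prod_t #|PZ (I t)| = \prod_t #|PX (I t)|)%N.
  by apply: eq_bigr => t _.
pose pr (tau : {ffun 'I_n -> idx}) := \prod_t p (tau t).
have [p0 p1 pnz prot] := sp.
have tot : 1 <= \sum_tau pr tau * h cX [ffun t => (tau t).1.1]
    + \sum_tau pr tau * h cY [ffun t => (tau t).1.2]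
    + \sum_tau pr tau * h cZ [ffun t => (tau t).2].
  have <- : \sum_tau pr tau = 1.
    rewrite -(bigA_distr_bigA (fun _ s => p s))/= p1.
    by rewrite big1.
  rewrite -!big_split/=; apply: ler_sum => tau _; rewrite -!mulrDr.
  have [->|/prodf_neq0 ptau] := eqVneq (pr tau) 0; first by rewrite !mul0r.
  rewrite -[leLHS]mulr1 ler_wpM2l//; first exact: prodr_ge0.
  have [|a [b [d [ab bd da abd]]]] := cblk [ffun t => (tau t).1.1]
      [ffun t => (tau t).1.2] [ffun t => (tau t).2].
    move=> t; rewrite !ffunE; apply: contraTT (ptau t isT) => /pnz.
    by case: (tau t) => [[? ?] ?] /= ->; rewrite eqxx.
  rewrite prodY in bd; rewrite prodZ in da.
  rewrite /h -ab -bd -da.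
  (* Positive mass forces all parts in the triple to be nonempty, so the block inequality can be
     divided by the product of the three dimensions. *)
  have abd0 : (0 < a * b * d)%N.
    have sz i : m i != 0 -> (0 < #|PX i|)%N by apply: marginal_support.
    have pos (pi : idx -> 'I_k) : (forall i, \sum_(s | pi s == i) p s = m i) ->
       (0 < \prod_t #|PX ([ffun t => pi (tau t)] t)|)%N.
      move=> pim; apply: prodn_gt0 => t; rewrite ffunE; apply: sz.
      rewrite -pim (bigD1 (tau t))//= gt_eqF// ltr_wpDr ?sumr_ge0//.
      by rewrite lt_neqAle eq_sym ptau// p0.
    have := pos (fun s => s.1.1) (fun=> erefl); rewrite -ab.
    have := pos (fun s => s.2) (fun i => proj2 (marginal_rot i prot)); rewrite -da.
    by rewrite !muln_gt0 => /andP[dp ap] /andP[_ bp]; rewrite ap bp dp.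
  have [a0 b0 d0] : [/\ a%:R != 0 :> R, b%:R != 0 :> R & d%:R != 0 :> R].
    by move: abd0; rewrite !muln_gt0 -!(ltr0n R) => /andP[/andP[? ?] ?]; split; rewrite gt_eqF.
  rewrite -(@ler_pM2l _ (a * b * d)%:R) ?ltr0n// mulr1.
  move: abd; rewrite -(ler_nat R); congr (_ <= _).
  by rewrite !natrD !natrM; field; rewrite a0 b0 d0.
have hX : \sum_(I : {ffun 'I_n -> 'I_k}) (\prod_t m (I t)) * h cX I <=
    (\sum_I cX I)%:R / expR c ^+ n + rho ^+ n.
  by apply: chern => I; case: (cle I).
have hY : \sum_(I : {ffun 'I_n -> 'I_k}) (\prod_t m (I t)) * h cY I <=
    (\sum_I cY I)%:R / expR c ^+ n + rho ^+ n.
  by apply: chern => I; rewrite -prodY; case: (cle I).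
have hZ : \sum_(I : {ffun 'I_n -> 'I_k}) (\prod_t m (I t)) * h cZ I <=
    (\sum_I cZ I)%:R / expR c ^+ n + rho ^+ n.
  by apply: chern => I; rewrite -prodZ; case: (cle I).
rewrite (sum_product_pushforward (fun s : idx => s.1.1)) in tot.
rewrite (sum_product_pushforward (fun s : idx => s.1.2)) in tot.
rewrite (sum_product_pushforward (fun s : idx => s.2)) in tot.
have margY (I : {ffun 'I_n -> 'I_k}) :
    \prod_t \sum_(s : idx | s.1.2 == I t) p s = \prod_t m (I t).
  by apply: eq_bigr => t _; case: (marginal_rot (I t) prot).
have margZ (I : {ffun 'I_n -> 'I_k}) :
    \prod_t \sum_(s : idx | s.2 == I t) p s = \prod_t m (I t).
  by apply: eq_bigr => t _; case: (marginal_rot (I t) prot).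
have e0 : 0 < expR c ^+ n by rewrite exprn_gt0 ?expR_gt0.
have : 1 <= S%:R / expR c ^+ n + 1 / 2.
  apply: le_trans tot _.
  under [X in _ + X + _]eq_bigr => I _ do rewrite margY.
  under [X in _ + _ + X]eq_bigr => I _ do rewrite margZ.
  have : (\sum_I cX I + \sum_I cY I + \sum_I cZ I)%:R / expR c ^+ n <= S%:R / expR c ^+ n.
    by rewrite ler_pM2r ?invr_gt0// ler_nat.
  by rewrite !natrD !mulrDl; move: hX hY hZ; rewrite -/(m _) /marginal; lra.
rewrite -lerBlDr (_ : 1 - 1 / 2 = 2^-1); last by lra.
by rewrite ler_pdivlMr// mulrC.
Qed.

End SymmetricDistributions.

(** * Upper bound *)

Section UpperBound.
Variables (R : realType) (F : fieldType) (X Y Z : finType) (k : nat).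
Variable T : tensor F X Y Z.
Variables (PX : 'I_k -> {set X}) (PY : 'I_k -> {set Y}) (PZ : 'I_k -> {set Z}).

Local Notation idx := ('I_k * 'I_k * 'I_k)%type.
Local Notation nz := (block_nonzero T PX PY PZ).
Local Notation sym := (sym_distr T PX PY PZ (R := R)).
Local Notation size := (fun i => #|PX i|%:R : R).

(** Markov's inequality for exponential weights: a light sequence contributes at least 1 to
    [expR c ^+ n] times the product of its weights, and over all sequences these products sum to at
    most 1. *)
Lemma card_light_sequences (U : finType) (P : 'I_k -> {set U}) (iU : U -> 'I_k)
    (v : 'I_k -> R) (c : R) n :
  (forall x i, (x \in P i) = (iU x == i)) ->
  \sum_i #|P i|%:R * expR (- v i) <= 1 ->
  #|[set x : {ffun 'I_n -> U} | \sum_t v (iU (x t)) <= c * n%:R]|%:R <= expR c ^+ n.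
Proof.
move=> UP v1; set A := [set x | _].
have sumU : \sum_u expR (- v (iU u)) <= 1.
  apply: le_trans v1; rewrite (partition_big iU xpredT)//=.
  apply: ler_sum => i _; rewrite -sum1_card natr_sum mulr_suml.
  rewrite (eq_bigl (fun u => u \in P i)) => [|u]; last by rewrite UP.
  by apply: ler_sum => u; rewrite UP => /eqP ->; rewrite mul1r.
rewrite -sum1_card natr_sum.
apply: le_trans (_ : \sum_(x in A) expR c ^+ n * \prod_t expR (- v (iU (x t))) <= _).
  apply: ler_sum => x; rewrite inE => xA.
  rewrite -expR_sum -expRM_natr -expRD -[leLHS]expR0 ler_expR sumrN.
  by rewrite subr_ge0.
apply: le_trans (_ : \sum_(x : {ffun 'I_n -> U}) expR c ^+ n * \prod_t expR (- v (iU (x t))) <= _).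
  rewrite [leRHS](bigID (mem A))/= lerDl sumr_ge0// => x _.
  by rewrite mulr_ge0 ?exprn_ge0 ?expR_ge0// prodr_ge0// => t _; apply: expR_ge0.
rewrite -mulr_sumr -(bigA_distr_bigA (fun _ u => expR (- v (iU u))))/=.
rewrite prodr_const card_ord ger_pMr ?exprn_gt0 ?expR_gt0//.
by rewrite exprn_ile1// sumr_ge0// => u _; apply: expR_ge0.
Qed.

(** The light x-, y- and z-sequences cover the support: three heavy sequences would have total
    weight above [3 * c * n], against the coordinatewise bound on nonzero blocks. *)
Lemma slice_rank_pow_upper (v : 'I_k -> R) c n :
  is_partition PX -> is_partition PY -> is_partition PZ ->
  (forall i, #|PX i| = #|PY i| /\ #|PY i| = #|PZ i|) ->
  \sum_i size i * expR (- v i) <= 1 ->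
  (forall i j l, nz i j l -> v i + v j + v l <= 3 * c) ->
  (slice_rank (tensor_pow T n))%:R <= 3 * expR c ^+ n.
Proof.
move=> /partition_index[iX iXP] /partition_index[iY iYP] /partition_index[iZ iZP].
move=> cards v1 vnz.
have v1Y : \sum_i #|PY i|%:R * expR (- v i) <= 1.
  by under eq_bigr => i _ do rewrite -(proj1 (cards i)).
have v1Z : \sum_i #|PZ i|%:R * expR (- v i) <= 1.
  by under eq_bigr => i _ do rewrite -(proj2 (cards i)) -(proj1 (cards i)).
have cX := card_light_sequences c n iXP v1.
have cY := card_light_sequences c n iYP v1Y.
have cZ := card_light_sequences c n iZP v1Z.
set A := [set x | _] in cX; set B := [set x | _] in cY; set C := [set x | _] in cZ.
have : (slice_rank (tensor_pow T n) <= #|A| + #|B| + #|C|)%N.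
  apply: slice_rank_le_cover => x y z; rewrite ffunE /= => /prodf_neq0 T0.
  rewrite !inE; apply: contraT; rewrite !negb_or -!ltNge => /and3P[xA yB zC].
  have : \sum_t v (iX (x t)) + \sum_t v (iY (y t)) + \sum_t v (iZ (z t))
      <= \sum_(t < n) 3 * c.
    rewrite -!big_split/=; apply: ler_sum => t _; apply: vnz.
    apply/block_nonzeroP; exists (x t), (y t), (z t).
    by rewrite iXP iYP iZP !eqxx T0.
  rewrite sumr_const card_ord -mulr_natr; lra.
rewrite -(ler_nat R) !natrD; lra.
Qed.

Lemma block_nonzero_rot i j l :
  (forall i j l, tensor_eq (block T PX PY PZ j l i) (rot_tensor (block T PX PY PZ i j l))) ->
  nz j l i = nz i j l.
Proof.
move=> rotT; have step a b d : nz b d a -> nz a b d.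
  have [f [g [h [_ _ _ E]]]] := rotT a b d.
  move=> /block_nonzeroP[x [y [z [xb yd za T0]]]].
  have := E (exist _ x xb) (exist _ y yd) (exist _ z za).
  rewrite !ffunE /= => TE; apply/block_nonzeroP.
  exists (val (h (exist _ z za))), (val (f (exist _ x xb))), (val (g (exist _ y yd))).
  by split; [exact: valP..|rewrite -TE].
(* One direction is a single rotation; the other is two, since three rotations give the identity. *)
by apply/idP/idP => [/step//|/step/step].
Qed.

(** Follows termwise from ln x <= x; it makes the supremum in the theorem finite. *)
Lemma entropy_le_size m : (forall i, 0 <= m i) ->
  (forall i, m i != 0 -> (0 < #|PX i|)%N) ->
  weighted_entropy size m <= \sum_i size i.
Proof.
move=> m0 ms; apply: ler_sum => i _; have [->|mi] := eqVneq (m i) 0.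
  by rewrite mul0r.
have mp : 0 < m i by rewrite lt_neqAle eq_sym mi m0.
rewrite -ler_pdivlMl// [leRHS]mulrC ltW// ln_sublinear// divr_gt0// ltr0n.
exact: ms.
Qed.

Section Symmetric.
Hypothesis rotT : forall i j l,
  tensor_eq (block T PX PY PZ j l i) (rot_tensor (block T PX PY PZ i j l)).

(** The uniform distribution on L is the interior point required by [entropy_dual]. *)
Lemma sym_uniform : (exists i j l, nz i j l) ->
  exists2 u : {ffun idx -> R}, sym u &
    exists2 kap, 0 < kap & forall i j l, nz i j l -> kap <= marginal u i.
Proof.
move=> [i0 [j0 [l0 nz0]]]; pose L := [set s : idx | nz s.1.1 s.1.2 s.2].
have L0 : 0 < #|L|%:R :> R.
  by rewrite ltr0n; apply/card_gt0P; exists (i0, j0, l0); rewrite inE.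
pose u : {ffun idx -> R} := [ffun s => (s \in L)%:R / #|L|%:R].
have u0 s : 0 <= u s by rewrite ffunE divr_ge0.
exists u; first split=> //.
- under eq_bigr => s _ do rewrite ffunE.
  rewrite -mulr_suml -natr_sum (_ : (\sum_s (s \in L))%N = #|L|).
    by rewrite divff// gt_eqF.
  by rewrite -sum1_card [RHS]big_mkcond; apply: eq_bigr => s _; case: (s \in L).
- by move=> i j l /negbTE nij; rewrite ffunE inE /= nij mul0r.
- by move=> i j l; rewrite !ffunE !inE /= (block_nonzero_rot i j l rotT).
exists (#|L|%:R^-1); first by rewrite invr_gt0.
move=> i j l nij; rewrite /marginal (bigD1 (i, j, l))//= ffunE inE /= nij mul1r.
by rewrite lerDl sumr_ge0.
Qed.

(** The uniform distribution on a cyclic orbit turns a bound on expectations over symmetric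
    distributions into a bound at each nonzero block. *)
Lemma sym_orbit i j l : nz i j l -> exists2 q : {ffun idx -> R}, sym q &
  forall v, \sum_i marginal q i * v i = (v i + v j + v l) / 3.
Proof.
move=> nij; pose s0 : idx := (i, j, l).
(* The rotations are counted with multiplicity, so a block fixed by rotation receives total mass
   1. *)
pose q : {ffun idx -> R} := [ffun s =>
  ((s == s0)%:R + (s == rot_idx s0)%:R + (s == rot_idx (rot_idx s0))%:R) / 3].
have qE v : \sum_s q s * v s = (v s0 + v (rot_idx s0) + v (rot_idx (rot_idx s0))) / 3.
  under eq_bigr => s _ do rewrite ffunE mulrAC !mulrDl.
  rewrite !big_split/= -!mulr_suml !mulrDl.
  have delta a : \sum_s (s == a)%:R * v s = v a.
    rewrite (bigD1 a)//= eqxx mul1r big1 ?addr0// => s /negbTE ->.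
    by rewrite mul0r.
  by rewrite !delta.
have rot3 : rot_idx (rot_idx (rot_idx s0)) = s0 by [].
have n1 : nz j l i by rewrite block_nonzero_rot.
have n2 : nz l i j by rewrite block_nonzero_rot.
exists q; first split.
- by move=> s; rewrite ffunE divr_ge0// !addr_ge0.
- have := qE (fun=> 1); under eq_bigr => s _ do rewrite mulr1.
  by move=> ->; field.
- move=> a b d nabd; rewrite ffunE.
  suff E s : nz s.1.1 s.1.2 s.2 -> ((a, b, d) == s) = false.
    by rewrite !E//= !add0r mul0r.
  by move=> ns; apply/negbTE; apply: contraNneq nabd => abd; rewrite -abd in ns.
- move=> a b d; rewrite !ffunE -[(b, d, a)]/(rot_idx (a, b, d)).
  have -> : (rot_idx (a, b, d) == s0) = ((a, b, d) == rot_idx (rot_idx s0)).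
    by rewrite -{1}rot3 (inj_eq (@rot_idx_inj k)).
  by rewrite !(inj_eq (@rot_idx_inj k)); congr (_ / _); ring.
by move=> v; rewrite marginal_expectation qE.
Qed.

End Symmetric.
End UpperBound.

(** * Convergence of the roots and the final equality *)

Lemma asymp_slice_rank_cvg (R : realType) (F : fieldType) (X Y Z : finType)
    (T : tensor F X Y Z) (l : R) :
  (powR (slice_rank (tensor_pow T n))%:R n%:R^-1 @[n --> \oo] --> l)%classic ->
  asymp_slice_rank R T = l.
Proof. by move=> cv; rewrite /asymp_slice_rank (cvg_limn_inf_sup cv).2. Qed.

Theorem theorem6p3 (R : realType) (F : fieldType) (X Y Z : finType) (k : nat)
    (T : tensor F X Y Z) (PX : 'I_k -> {set X}) (PY : 'I_k -> {set Y})
    (PZ : 'I_k -> {set Z}) :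
  minimal T ->
  is_partition PX -> is_partition PY -> is_partition PZ ->
  laser_ready T PX PY PZ ->
  asymp_slice_rank R T =
    sup [set p_X T PX PY PZ p | p in sym_distr T PX PY PZ (R := R)]%classic.
Proof.
move=> [minX _ _] partX partY partZ laser.
have [mm tight _ [cards rotT]] := laser.
have [iX iXP] := partition_index partX; have [iY iYP] := partition_index partY.
have [iZ iZP] := partition_index partZ.
set E := [set p_X T PX PY PZ p | p in _]%classic.
have Tnz x y z : T (x, y, z) != 0 ->
    block_nonzero T PX PY PZ (iX x) (iY y) (iZ z).
  move=> T0; apply/block_nonzeroP; exists x, y, z.
  by rewrite iXP iYP iZP !eqxx.
(* Without nonzero blocks there is no distribution and the supremum of the empty set is 0 by
   convention; the slice rank of every positive power is 0 as well. *)
have [nzT|nonz] := pselect (exists i j l, block_nonzero T PX PY PZ i j l); last first.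
  have E0 : E = set0.
    apply/seteqP; split=> // r [p [p0 p1 pnz _] _].
    have : \sum_t p t = 0.
      apply: big1 => -[[i j] l] _; apply: pnz; apply/negP => nij.
      by apply: nonz; exists i, j, l.
    by rewrite p1 => /eqP; rewrite oner_eq0.
  rewrite E0 sup0; apply: asymp_slice_rank_cvg.
  have S0 n : (0 < n)%N -> slice_rank (tensor_pow T n) = 0%N.
    move=> n0; apply/eqP; rewrite -leqn0.
    have := @slice_rank_le_cover F _ _ _ (tensor_pow T n) finset.set0 finset.set0 finset.set0.
    rewrite !cards0; apply=> x y z; rewrite ffunE /= => /prodf_neq0.
    move=> /(_ (Ordinal n0) isT)/Tnz nij; case: nonz.
    by do 3!eexists; exact: nij.
  apply: cvg_near_cst; near=> n.
  have n0 : (0 < n)%N by near: n; exact: nbhs_infty_gt.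
  by rewrite S0// powR0// invr_eq0 pnatr_eq0 -lt0n.
have [u symu [kap kap0 ukap]] := sym_uniform R rotT nzT.
pose N i := #|PX i|%:R : R.
have EN p : sym_distr T PX PY PZ p -> weighted_entropy N (marginal p) <= \sum_i N i.
  move=> sp; apply: entropy_le_size => i; first exact: marginal_ge0 sp.
  exact: (marginal_support sp).
have supE : has_sup E.
  split; first by exists (p_X T PX PY PZ u), u.
  exists (expR (\sum_i N i)) => _ [p sp <-].
  by rewrite p_X_entropy// ler_expR EN.
have G0 : 0 < sup E.
  apply: lt_le_trans (_ : p_X T PX PY PZ u <= _).
    by rewrite p_X_entropy// expR_gt0.
  by apply: ub_le_sup; [case: supE | exists u].
rewrite -(lnK (G0 : sup E \in Num.pos)).
apply: asymp_slice_rank_cvg; apply: root_limit => c cL; last first.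
  have : expR c < sup E by rewrite -[sup E]lnK// ltr_expR.
  move=> /(sup_gt (proj1 supE))[_ [p sp <-]]; rewrite p_X_entropy// ltr_expR.
  exact: slice_rank_pow_lower.
(* For the upper bound, duality is applied to the convex set of marginals of symmetric
   distributions, on which the entropy is at most [ln (sup E)]. *)
pose D (m : 'I_k -> R) := exists2 p : {ffun 'I_k * 'I_k * 'I_k -> R},
  sym_distr T PX PY PZ p & m = marginal p.
have [v [v1 vc]] : exists v : 'I_k -> R, \sum_i N i * expR (- v i) <= 1 /\
    forall q, D q -> \sum_i q i * v i <= c.
  apply: (@entropy_dual R k N D (marginal u) kap (ln (sup E)) c) => //.
  - by move=> i; rewrite /N; case: #|PX i| => [|a]; [left|right; rewrite ler1n].
  - move=> m [p sp ->]; split; first by move=> i; exact: marginal_ge0 sp.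
      exact: marginal_sum sp.
    move=> i Ni; apply/eqP; apply: contraT => /(marginal_support sp).
    by rewrite -(ltr0n R) -/(N i) Ni ltxx.
  - move=> _ _ s [p sp ->] [q sq ->] /andP[s0 s1].
    exists [ffun t => (1 - s) * p t + s * q t]; last first.
      apply/funext => i; rewrite /marginal !mulr_sumr -big_split/=.
      by apply: eq_bigr => t _; rewrite ffunE.
    have [p0 p1 pnz prot] := sp; have [q0 q1 qnz qrot] := sq; split.
    + by move=> t; rewrite ffunE addr_ge0// mulr_ge0// subr_ge0.
    + under eq_bigr => t _ do rewrite ffunE.
      by rewrite big_split/= -!mulr_sumr p1 q1 !mulr1 subrK.
    + by move=> i j l nij; rewrite ffunE pnz// qnz// !mulr0 addr0.
    + by move=> i j l; rewrite !ffunE prot qrot.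
  - by exists u.
  (* By minimality each nonempty part of X meets a nonzero block, so its marginal under [u] is at
     least [kap]. *)
  - move=> i; rewrite /N ler1n => /card_gt0P[x xi].
    have [y [z /Tnz nij]] := minX x; move: xi; rewrite iXP => /eqP xi.
    by rewrite xi in nij; apply: ukap nij.
  - move=> _ [p sp ->]; rewrite -ler_expR lnK// -(p_X_entropy sp).
    by apply: ub_le_sup; [case: supE | exists p].
move=> n; apply: (slice_rank_pow_upper n partX partY partZ cards v1) => i j l nij.
have [q sq qv] := sym_orbit R rotT nij.
have := vc (marginal q) (ex_intro2 _ _ q sq erefl); rewrite qv; lra.
Unshelve. all: by end_near.
Qed.
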